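(* Let $E\subseteq\mathbb{Z}$. The following are equivalent. (i) $E$ is pseudo-independent. (ii) $E$ enjoys $(\mathcal{I}_\infty)$. (iii) For every $\varepsilon>0$ and $m\ge1$, there is a finite subset $G\subseteq E$ such that the Sidon constant of any subset of $E\setminus G$ with $m$ elements is less than $1+\varepsilon$.
   Context: $\mathbb{T}=\{z\in\mathbb{C}:|z|=1\}$ with normalized Haar measure $m[\cdot]$; $e_n(z)=z^n$, viewed as a random variable on $(\mathbb{T},m)$. $E$ is pseudo-independent if for all $n\ge1$ and all measurable $A_1,\dots,A_n\subseteq\mathbb{T}$, $m[e_{p_i}\in A_i:1\le i\le n]\to\prod_{i=1}^nm[A_i]$ as the distinct elements $p_1,\dots,p_n\in E$ tend to infinity (i.e. for each $\delta>0$ there is a finite $G\subseteq E$ such that the difference is at most $\delta$ in absolute value for all distinct $p_1,\dots,p_n\in E\setminus G$). $E$ enjoys $(\mathcal{I}_\infty)$ if for every $k\ge1$ and every $\zeta\in(\mathbb{Z}\setminus\{0\})^k$ with $\zeta_1+\dots+\zeta_k=0$ there is a finite set $G\subseteq E$ such that $\zeta_1r_1+\dots+\zeta_kr_k\ne0$ for all distinct $r_1,\dots,r_k\in E\setminus G$. The Sidon constant of $E'\subseteq\mathbb{Z}$ is the infimum of the $C$ such that $\sum_{q\in H}|a_q|\le C\|\sum_{q\in H}a_qe_q\|_\infty$ for all finite $H\subseteq E'$ and $a_q\in\mathbb{C}$. *)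

(* Defs.v *)
From HB Require Import structures.
From mathcomp Require Import all_boot all_order all_algebra.
From mathcomp Require Import finmap complex.
From mathcomp Require Import all_classical all_reals all_analysis.
From mathcomp Require Import measurable_realfun.

Set Implicit Arguments.
Unset Strict Implicit.
Unset Printing Implicit Defensive.

Import Order.TTheory GRing.Theory Num.Theory.
Import numFieldNormedType.Exports.
Import Normc.

Local Open Scope classical_set_scope.
Local Open Scope ring_scope.
Local Open Scope complex_scope.

(* The topology on R[i] comes from its structure of numFieldType, hence the   *)
(* ^o; borelC R is R[i] with the Borel sigma-algebra of that topology.        *)
Definition borelC (R : realType) := g_sigma_algebraType (@open R[i]^o).

HB.instance Definition _ (R : realType) := Measurable.on (borelC R).

Definition circle (R : realType) : set R[i] := [set z | `|z| = 1].

Definition cexp (R : realType) (t : measurableTypeR R) : borelC R :=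
  cos (pi *+ 2 * t) +i* sin (pi *+ 2 * t).

Section haar.
Variable R : realType.

Lemma circle_cexp (t : R) : circle (cexp t).
Proof. by rewrite /circle/= normc_def cos2Dsin2 sqrtr1. Qed.

Let norm_complex_lt (a b c d : R) (e : R[i]) : 0 < e ->
  `|a - c| < complex.Re e / 2 -> `|b - d| < complex.Re e / 2 ->
  `|(a +i* b) - (c +i* d)| < e.
Proof.
move=> e0 ac bd.
have -> : e = (complex.Re e)%:C.
  by case: e e0 {ac bd} => x y; rewrite ltcE/= => /andP[/eqP -> _].
have -> : ((a +i* b) - (c +i* d) : R[i]) = (a - c)%:C + 'i * (b - d)%:C.
  apply/eqP; rewrite eq_complex/=.
  by rewrite !(mul0r, mul1r, addr0, add0r, mulr0, subr0) !eqxx.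
have n_i : `|'i : R[i]| = 1 by rewrite normc_def/= expr0n expr1n add0r sqrtr1.
apply: (le_lt_trans (ler_normD _ _)).
rewrite normrM n_i mul1r !normc_def/= expr0n/= !addr0 !sqrtr_sqr -rmorphD/= ltcR.
by rewrite [ltRHS]splitr ltrD.
Qed.

Lemma continuous_cexp : continuous (@cexp R : R -> R[i]^o).
Proof.
move=> t; apply/cvgrPdist_lt => /= e e0.
have e2 : 0 < complex.Re e / 2.
  by case: e e0 => a b; rewrite ltcE/= => /andP[_ a0]; rewrite divr_gt0.
have lint : {for t, continuous (fun u : R => pi *+ 2 * u)}.
  exact: mulrl_continuous.
have /cvgrPdist_lt/(_ _ e2) Hc :=
  continuous_comp lint (@continuous_cos R (pi *+ 2 * t)).
have /cvgrPdist_lt/(_ _ e2) Hs :=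
  continuous_comp lint (@continuous_sin R (pi *+ 2 * t)).
near=> u; apply: norm_complex_lt => //; first by near: u.
by near: u.
Unshelve. all: by end_near. Qed.

Lemma measurable_cexp : measurable_fun [set: measurableTypeR R] (@cexp R).
Proof.
refine (@measurability _ _ (measurableTypeR R) (borelC R) setT (@cexp R)
  (@open R[i]^o) erefl _).
move=> _ [A oA <-]; rewrite setTI; apply: open_measurable.
by move: A oA; apply/continuousP; exact: continuous_cexp.
Qed.

HB.instance Definition _ :=
  isMeasurableFun.Build _ _ _ _ (@cexp R) measurable_cexp.

End haar.

(* Normalized Haar measure of the circle, as a probability on R[i] carried by *)
(* the circle (haar_circle): the law of exp (2 i pi t), t uniform on [0, 1].  *)
Definition haar (R : realType) : set (borelC R) -> \bar R :=
  distribution (uniform_prob (@ltr01 R)) (@cexp R).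

HB.instance Definition _ (R : realType) := Probability.on (@haar R).

Lemma haar_circle (R : realType) : haar (@circle R) = 1%E.
Proof.
rewrite -(probability_setT (@haar R)); congr (uniform_prob _ _).
by apply/seteqP; split => // t _; exact: circle_cexp.
Qed.

Definition echar (R : realType) (n : int) (z : R[i]) : R[i] := z ^ n.

Definition pseudo_independent (R : realType) (E : set int) : Prop :=
  forall (n : nat) (A : 'I_n -> set (borelC R)), (1 <= n)%N ->
    (forall i, measurable (A i)) -> (forall i, A i `<=` @circle R) ->
  forall delta : R, 0 < delta ->
  exists G : set int, [/\ finite_set G, G `<=` E &
    forall p : 'I_n -> int, injective p -> (forall i, (E `\` G) (p i)) ->
      `| fine (haar (@circle R `&` [set z | forall i, A i (echar (p i) z)]))
         - \prod_(i < n) fine (haar (A i)) | <= delta].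

Definition I_infty (E : set int) : Prop :=
  forall (k : nat) (zeta : 'I_k -> int), (1 <= k)%N ->
    (forall i, zeta i != 0) -> \sum_(i < k) zeta i = 0 ->
  exists G : set int, [/\ finite_set G, G `<=` E &
    forall r : 'I_k -> int, injective r -> (forall i, (E `\` G) (r i)) ->
      \sum_(i < k) zeta i * r i != 0].

(* normc is the modulus with values in R; `| _ | on R[i] takes values in R[i].*)
Definition supnorm (R : realType) (f : R[i] -> R[i]) : R :=
  sup [set normc (f z) | z in @circle R].

Definition sidon_bound (R : realType) (E : set int) (C : R) : Prop :=
  forall (H : {fset int}) (a : int -> R[i]), [set` H] `<=` E ->
    \sum_(q <- H) normc (a q) <=
      C * supnorm (fun z => \sum_(q <- H) a q * echar q z).

(* +oo when no finite C is admissible. *)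
Definition sidon_constant (R : realType) (E : set int) : \bar R :=
  ereal_inf [set C%:E | C in @sidon_bound R E].

(* Main.v *)
(** The proof goes round (i) => (iii) => (ii) => (i).

(i) => (iii): for [p_1, ..., p_m] far out in [E], the points
[(e_{p_1}(z), ..., e_{p_m}(z))] come close to every point of the torus, because
products of small arcs have positive measure; a trigonometric polynomial with
spectrum [{p_1, ..., p_m}] then nearly attains the sum of the moduli of its
coefficients.

(iii) => (ii): if [sum_i zeta_i r_i = 0], then [z^{r_i}] lies in the subgroup
[prod_i w_i^{zeta_i} = 1] of the torus. Take phases [c_i] with
[prod_i c_i^{zeta_i} = -1]. If [sum_i c_i z^{r_i}] had modulus close to [k],
the numbers [c_i z^{r_i}] would be almost equal, and [sum_i zeta_i = 0] would
force [prod_i (c_i z^{r_i})^{zeta_i}] to be close to [1] instead of [-1]; so the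
Sidon constant of [{r_1, ..., r_k}] stays away from [1].

(ii) => (i): far out in [E] there is no nontrivial relation with bounded
coefficients at all, even when they do not sum to zero. So (i) holds exactly,
far enough, for trigonometric polynomials instead of indicator functions.
Indicator functions of Borel sets are approximated in [L^2] by trigonometric
polynomials with values in [[0, 1]], and the error is uniform in [p] because
[t |-> p t] preserves the uniform measure modulo 1. *)

Require Import Defs.
From HB Require Import structures.
From mathcomp Require Import all_boot all_order all_algebra.
From mathcomp Require Import finmap complex.
From mathcomp Require Import all_classical all_reals all_analysis.
From mathcomp Require Import measurable_realfun ring lra zify.

Set Implicit Arguments.
Unset Strict Implicit.
Unset Printing Implicit Defensive.

Import Order.TTheory GRing.Theory Num.Theory.
Import numFieldNormedType.Exports.
Import Normc.

Local Open Scope classical_set_scope.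
Local Open Scope ring_scope.

(** * Means of bounded measurable functions under a probability *)

Section mean.
Context d (T : measurableType d) (R : realType) (P : probability T R).
Implicit Types f g : T -> R.

Definition bounded_measurable f :=
  measurable_fun setT f /\ exists M, forall x, `|f x| <= M.

Definition mean f := \int[P]_x f x.

Lemma bounded_measurable_integrable f :
  bounded_measurable f -> P.-integrable setT (EFin \o f).
Proof.
move=> [mf [M fM]]; apply: measurable_bounded_integrable => //.
  by rewrite (le_lt_trans (probability_le1 P measurableT))// ltry.
exists M; split; first exact: num_real.
by move=> x Mx y _; exact: le_trans (fM y) (ltW Mx).
Qed.

Lemma bounded_measurable_cst c : bounded_measurable (fun=> c).
Proof. by split; [exact: measurable_cst | exists `|c|]. Qed.

Lemma bounded_measurableD f g : bounded_measurable f ->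
  bounded_measurable g -> bounded_measurable (fun x => f x + g x).
Proof.
move=> [mf [M fM]] [mg [N gN]]; split; first exact: measurable_funD.
by exists (M + N) => x; exact: le_trans (ler_normD _ _) (lerD (fM x) (gN x)).
Qed.

Lemma bounded_measurableM f g : bounded_measurable f ->
  bounded_measurable g -> bounded_measurable (fun x => f x * g x).
Proof.
move=> [mf [M fM]] [mg [N gN]]; split; first exact: measurable_funM.
by exists (M * N) => x; rewrite normrM ler_pM.
Qed.

Lemma bounded_measurableZ c f : bounded_measurable f ->
  bounded_measurable (fun x => c * f x).
Proof. by move=> ?; apply: bounded_measurableM; first exact: bounded_measurable_cst. Qed.

Lemma bounded_measurableN f : bounded_measurable f ->
  bounded_measurable (fun x => - f x).
Proof.
move=> /(bounded_measurableZ (-1)) h.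
by rewrite (_ : (fun _ => _) = (fun x => -1 * f x))//; apply/funext => x; rewrite mulN1r.
Qed.

Lemma bounded_measurableB f g : bounded_measurable f ->
  bounded_measurable g -> bounded_measurable (fun x => f x - g x).
Proof. by move=> ? ?; apply: bounded_measurableD; last exact: bounded_measurableN. Qed.

Lemma bounded_measurable_norm f : bounded_measurable f ->
  bounded_measurable (fun x => `|f x|).
Proof.
move=> [mf [M fM]]; split; first exact: measurableT_comp.
by exists M => x; rewrite normr_id.
Qed.

Lemma bounded_measurableX n f : bounded_measurable f ->
  bounded_measurable (fun x => f x ^+ n).
Proof.
move=> bf; elim: n => [|n ih]; first exact: bounded_measurable_cst.
by under eq_fun do rewrite exprS; exact: bounded_measurableM.
Qed.

Lemma bounded_measurable_sum I (r : seq I) (F : I -> T -> R) :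
  (forall i, bounded_measurable (F i)) ->
  bounded_measurable (fun x => \sum_(i <- r) F i x).
Proof.
move=> bF; elim: r => [|i r ih].
  by under eq_fun do rewrite big_nil; exact: bounded_measurable_cst.
by under eq_fun do rewrite big_cons; exact: bounded_measurableD.
Qed.

Lemma bounded_measurable_prod I (r : seq I) (F : I -> T -> R) :
  (forall i, bounded_measurable (F i)) ->
  bounded_measurable (fun x => \prod_(i <- r) F i x).
Proof.
move=> bF; elim: r => [|i r ih].
  by under eq_fun do rewrite big_nil; exact: bounded_measurable_cst.
by under eq_fun do rewrite big_cons; exact: bounded_measurableM.
Qed.

Lemma bounded_measurable_indic (A : set T) : measurable A ->
  bounded_measurable (\1_A : T -> R).
Proof.
move=> mA; split; first exact: measurable_indic.
by exists 1 => x; rewrite indicE; case: (x \in A); rewrite /= ?normr1 ?normr0.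
Qed.

Lemma mean_cst c : mean (fun=> c) = c.
Proof.
rewrite /mean Rintegral_cst// -[RHS]mulr1; congr (_ * _).
exact: (congr1 fine (probability_setT P)).
Qed.

Lemma meanD f g : bounded_measurable f -> bounded_measurable g ->
  mean (fun x => f x + g x) = mean f + mean g.
Proof.
by move=> bf bg; rewrite /mean RintegralD//; exact: bounded_measurable_integrable.
Qed.

Lemma meanB f g : bounded_measurable f -> bounded_measurable g ->
  mean (fun x => f x - g x) = mean f - mean g.
Proof.
by move=> bf bg; rewrite /mean RintegralB//; exact: bounded_measurable_integrable.
Qed.

Lemma meanZ c f : bounded_measurable f -> mean (fun x => c * f x) = c * mean f.
Proof.
by move=> bf; rewrite /mean RintegralZl//; exact: bounded_measurable_integrable.
Qed.

Lemma mean_sum I (r : seq I) (F : I -> T -> R) :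
  (forall i, bounded_measurable (F i)) ->
  mean (fun x => \sum_(i <- r) F i x) = \sum_(i <- r) mean (F i).
Proof.
move=> bF; elim: r => [|i r ih].
  by under eq_fun do rewrite big_nil; rewrite big_nil mean_cst.
under eq_fun do rewrite big_cons.
by rewrite big_cons meanD// ?ih//; exact: bounded_measurable_sum.
Qed.

Lemma le_mean f g : bounded_measurable f -> bounded_measurable g ->
  (forall x, f x <= g x) -> mean f <= mean g.
Proof.
by move=> bf bg fg; apply: le_Rintegral => //; exact: bounded_measurable_integrable.
Qed.

Lemma mean_ge0 f : (forall x, 0 <= f x) -> 0 <= mean f.
Proof. by move=> f0; apply: Rintegral_ge0. Qed.

Lemma mean_indic (A : set T) : measurable A -> mean (\1_A) = fine (P A).
Proof. by move=> mA; rewrite /mean /Rintegral integral_indic// setIT. Qed.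

Lemma mean_dominated_cvg (f : nat -> T -> R) g M :
  (forall n, measurable_fun setT (f n)) -> (forall n x, `|f n x| <= M) ->
  (forall x, f n x @[n --> \oo] --> g x) ->
  mean (f n) @[n --> \oo] --> mean g.
Proof.
move=> mf fM fg.
have mg : measurable_fun setT g.
  by apply: (measurable_fun_cvg mf) => x _; exact: fg.
have gM x : `|g x| <= M.
  have h : `|f n x| @[n --> \oo] --> `|g x| by apply: cvg_norm; exact: fg.
  rewrite -(cvg_lim _ h)//; apply: limr_le; last exact: nearW.
  by apply/cvg_ex; eexists; exact: h.
have bg : bounded_measurable g by split=> //; exists M.
apply: fine_cvg.
rewrite fineK; last first.
  by apply: integrable_fin_num => //; exact: bounded_measurable_integrable.
apply: (@dominated_cvg _ _ _ P setT measurableT _ _ (cst M%:E)) => //.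
- by move=> n; exact/measurable_EFinP.
- by move=> x _; apply/cvg_EFin; [exact: nearW | exact: fg].
- by apply: bounded_measurable_integrable; exact: bounded_measurable_cst.
- by move=> n x _; rewrite /= lee_fin.
Qed.

End mean.

(** * Real trigonometric polynomials *)

Section trigpoly.
Variable R : realType.
Implicit Types f g : R -> R.

(** [x] is a triple (amplitude, frequency, phase). With a free phase, cosines alone span the real
    trigonometric polynomials, and a product of two of them is a sum of two of the same kind. *)
Definition trigmon (x : R * int * R) (t : R) : R :=
  x.1.1 * cos (pi *+ 2 * (x.1.2%:~R * t) + x.2).

Definition trigsum (s : seq (R * int * R)) (t : R) : R :=
  \sum_(x <- s) trigmon x t.

Definition trigpoly f := exists s, f = trigsum s.

Lemma trigpoly_mon x : trigpoly (trigmon x).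
Proof. by exists [:: x]; apply/funext => t; rewrite /trigsum big_seq1. Qed.

Lemma trigpoly_cst a : trigpoly (fun=> a).
Proof.
rewrite (_ : (fun=> a) = trigmon (a, 0, 0)); first exact: trigpoly_mon.
by apply/funext => t; rewrite /trigmon/= mul0r mulr0 addr0 cos0 mulr1.
Qed.

Lemma trigpolyD f g : trigpoly f -> trigpoly g -> trigpoly (fun t => f t + g t).
Proof.
move=> [s ->] [u ->]; exists (s ++ u).
by apply/funext => t; rewrite /trigsum big_cat.
Qed.

Lemma trigpoly_sum I (r : seq I) (F : I -> R -> R) :
  (forall i, trigpoly (F i)) -> trigpoly (fun t => \sum_(i <- r) F i t).
Proof.
move=> tF; elim: r => [|i r ih].
  by under eq_fun do rewrite big_nil; exact: trigpoly_cst.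
by under eq_fun do rewrite big_cons; exact: trigpolyD.
Qed.

Lemma cosM (x y : R) : cos x * cos y = 2^-1 * cos (x + y) + 2^-1 * cos (x - y).
Proof. by rewrite cosD cosB; field. Qed.

Lemma trigmonM x y : trigpoly (fun t => trigmon x t * trigmon y t).
Proof.
case: x y => -[a j] c [[b k] d].
rewrite (_ : (fun _ => _) =
  fun t => trigmon (a * b / 2, j + k, c + d) t + trigmon (a * b / 2, j - k, c - d) t).
  by apply: trigpolyD; exact: trigpoly_mon.
apply/funext => t; rewrite /trigmon/= mulrACA cosM mulrDr !mulrA.
by congr (_ * cos _ + _ * cos _); rewrite !rmorphD /= ?rmorphN; ring.
Qed.

Lemma trigpolyM f g : trigpoly f -> trigpoly g -> trigpoly (fun t => f t * g t).
Proof.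
move=> [s ->] [u ->].
rewrite (_ : (fun _ => _) =
  fun t => \sum_(x <- s) \sum_(y <- u) trigmon x t * trigmon y t).
  by do 2 (apply: trigpoly_sum => ?); exact: trigmonM.
by apply/funext => t; rewrite mulr_suml; apply: eq_bigr => x _; rewrite mulr_sumr.
Qed.

Lemma trigpolyB f g : trigpoly f -> trigpoly g -> trigpoly (fun t => f t - g t).
Proof.
move=> tf tg; under eq_fun do rewrite -mulN1r.
by apply: trigpolyD => //; apply: trigpolyM => //; exact: trigpoly_cst.
Qed.

Lemma trigpolyX n f : trigpoly f -> trigpoly (fun t => f t ^+ n).
Proof.
move=> tf; elim: n => [|n ih]; first exact: trigpoly_cst.
by under eq_fun do rewrite exprS; exact: trigpolyM.
Qed.

Lemma continuous_cos_linear (a c : R) : continuous (fun t : R => cos (a * t + c)).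
Proof.
move=> t; apply: (@continuous_comp _ _ _ (fun t => a * t + c) cos).
  apply: cvgD; last exact: cvg_cst.
  exact: mulrl_continuous.
exact: continuous_cos.
Qed.

Lemma trigpoly_bounded_measurable f : trigpoly f ->
  @bounded_measurable _ (measurableTypeR R) R f.
Proof.
move=> [s ->]; apply: (@bounded_measurable_sum _ (measurableTypeR R)) => -[[a j] c].
apply: bounded_measurableZ; split.
  apply: continuous_measurable_fun => /= t.
  have := @continuous_cos_linear (pi *+ 2 * j%:~R) c t.
  by under eq_fun do rewrite -mulrA.
by exists 1 => t; exact: cos_max.
Qed.

End trigpoly.

(** * Orthogonality of characters on [0, 1] *)

Section uniform_mean.
Variable R : realType.
Local Notation P := (uniform_prob (@ltr01 R)).
Local Notation T := (measurableTypeR R).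

Lemma mean_cos_full_period (k : int) (c : R) : k != 0 ->
  mean P (fun t : T => cos (pi *+ 2 * (k%:~R * t) + c)) = 0.
Proof.
move=> k0.
set f := fun t => _.
have bf : @bounded_measurable _ T R f.
  have := trigpoly_bounded_measurable (trigpoly_mon (1, k, c)).
  by rewrite /trigmon/=; under eq_fun do rewrite mul1r.
pose w : R := pi *+ 2 * k%:~R.
have w0 : w != 0 by rewrite mulf_neq0 ?intr_eq0// mulrn_eq0/= gt_eqF// pi_gt0.
(* Adding the constant 1 makes the integrand nonnegative, as [integral_uniform] requires. *)
suff: mean P (fun t => 1 + f t) = 1.
  rewrite meanD ?mean_cst//; last exact: bounded_measurable_cst.
  by move=> /(congr1 (fun x => x - 1)); rewrite addrAC subrr add0r.
rewrite /mean /Rintegral integral_uniform; last 2 first.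
- by apply/measurable_EFinP; apply: measurable_funD => //; case: bf.
- by move=> t; rewrite lee_fin -lerBlDl sub0r cos_geN1.
pose F (t : R) : R := t + w^-1 * sin (w * t + c).
have dF (x : R) : is_derive x 1 F (1 + f x).
  have h : is_derive x 1 (fun t : R => w * t + c) w.
    by apply: is_derive_eq; rewrite addr0 scaler1.
  have h2 : is_derive x 1 (fun t : R => sin (w * t + c)) (cos (w * x + c) * w).
    exact: (@is_derive1_comp _ _ (fun t : R => w * t + c)).
  rewrite /F; apply: is_derive_eq.
  by rewrite /f [pi *+ 2 * (_ * _)]mulrA -/w /GRing.scale/= mulrCA mulVf// mulr1.
have cF (x : R) : {for x, continuous F}.
  by apply: differentiable_continuous; apply/derivable1_diffP; case: (dF x).
rewrite (@continuous_FTC2 _ (fun t => 1 + f t) F) ?ltr01//; last first.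
- by move=> x _; rewrite derive1E; exact: derive_val.
- split.
  + by move=> x _; case: (dF x).
  + by apply: cvg_at_right_filter; exact: cF.
  + by apply: cvg_at_left_filter; exact: cF.
- apply: continuous_subspaceT => x.
  apply: cvgD; first exact: cvg_cst.
  have := @continuous_cos_linear R w c x.
  by rewrite /w /f; under eq_fun do rewrite -mulrA.
rewrite subr0 invr1 mul1e/= /F mulr0 !add0r mulr1.
suff -> : sin (w + c) = sin c by ring.
rewrite addrC /w.
have sinDn (n : nat) x : sin (x + pi *+ 2 * n%:R) = sin x :> R.
  by rewrite mulr_natr periodicn//; exact: sinD2pi.
case: k {k0 f bf w w0 F dF cF} => n; first by rewrite sinDn.
by rewrite NegzE rmorphN/= mulrN -[RHS](sinDn n.+1) -(sinDn n.+1 (c - _)) subrK sinDn.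
Qed.

Lemma mean_trigmon a (k : int) c :
  mean P (trigmon (a, k, c)) = if k == 0 then a * cos c else 0.
Proof.
have [->|k0] := eqVneq.
  rewrite -(mean_cst P (a * cos c)); congr mean; apply/funext => t.
  by rewrite /trigmon/= mul0r mulr0 add0r.
rewrite /trigmon/= meanZ ?mean_cos_full_period ?mulr0//.
have := trigpoly_bounded_measurable (trigpoly_mon (1, k, c)).
by rewrite /trigmon/=; under eq_fun do rewrite mul1r.
Qed.

End uniform_mean.

(** * Exact independence of dilated trigonometric polynomials *)

Section independence.
Variable R : realType.
Local Notation P := (uniform_prob (@ltr01 R)).
Local Notation T := (measurableTypeR R).

(** Unlike in [I_infty], the coefficients may have any sum; [M] will bound the frequencies of the
    polynomials to be made independent. *)
Definition nonresonant (M n : nat) (p : 'I_n -> int) : Prop :=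
  forall zeta : 'I_n -> int, (forall i, (`|zeta i| <= M)%N) ->
    (exists i, zeta i != 0) -> \sum_(i < n) zeta i * p i != 0.

Lemma trigmon_dilate x (k : int) (t : R) :
  trigmon x (k%:~R * t) = trigmon (x.1.1, x.1.2 * k, x.2) t.
Proof. by rewrite /trigmon/= intrM -mulrA. Qed.

Lemma trigpoly_dilate f (k : int) : trigpoly f ->
  trigpoly (fun t : R => f (k%:~R * t)).
Proof.
move=> [s ->]; apply: trigpoly_sum => x.
by under eq_fun do rewrite trigmon_dilate; exact: trigpoly_mon.
Qed.

Lemma trigmonM_dilate (a : R) (N : int) c x k t :
  trigmon (a, N, c) t * trigmon x (k%:~R * t) =
  trigmon (a * x.1.1 / 2, N + x.1.2 * k, c + x.2) t +
  trigmon (a * x.1.1 / 2, N - x.1.2 * k, c - x.2) t.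
Proof.
case: x => -[b j] d; rewrite /trigmon/= mulrACA cosM mulrDr !mulrA.
by congr (_ * cos _ + _ * cos _); rewrite !rmorphD /= ?rmorphN /= intrM; ring.
Qed.

(** Expanding the product by [cosM] yields monomials whose frequencies are [N] plus a signed sum of
    the [(x i).1.2 * p i]; [zeta] covers all choices of signs. None of these frequencies vanishes,
    so each monomial has mean 0. The factor [trigmon (a, N, c)] accumulates, in the induction, what
    has been expanded already. *)
Lemma mean_prod_trigmon_eq0 (I : eqType) (r : seq I) (x : I -> R * int * R)
    (p : I -> int) a N c : uniq r ->
  (forall zeta : I -> int, (forall i, `|zeta i|%N = `|(x i).1.2|%N) ->
     N + \sum_(i <- r) zeta i * p i != 0) ->
  mean P (fun t : T => trigmon (a, N, c) t *
    \prod_(i <- r) trigmon (x i) ((p i)%:~R * t)) = 0.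
Proof.
elim: r a N c => [|i r ih] a N c.
  move=> _ /(_ (fun i => (x i).1.2) (fun=> erefl)).
  rewrite big_nil addr0 => N0.
  by under eq_fun do rewrite big_nil mulr1; rewrite mean_trigmon (negbTE N0).
move=> /=/andP[ir ur] H.
under eq_fun do rewrite big_cons mulrA trigmonM_dilate mulrDl.
have bm y : @bounded_measurable _ T R
    (fun t => trigmon y t * \prod_(j <- r) trigmon (x j) ((p j)%:~R * t)).
  apply: bounded_measurableM.
    exact/trigpoly_bounded_measurable/trigpoly_mon.
  apply: bounded_measurable_prod => j.
  by apply/trigpoly_bounded_measurable/trigpoly_dilate/trigpoly_mon.
have step (e : int) : `|e|%N = `|(x i).1.2|%N -> forall zeta : I -> int,
    (forall i, `|zeta i|%N = `|(x i).1.2|%N) ->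
    N + e * p i + \sum_(j <- r) zeta j * p j != 0.
  move=> he zeta hz.
  have := H (fun j => if j == i then e else zeta j).
  rewrite big_cons eqxx addrA.
  rewrite (_ : \sum_(j <- r) _ = \sum_(j <- r) zeta j * p j).
    by apply=> j; case: eqP => // ->.
  apply: eq_big_seq => j jr; case: eqP => // ji.
  by move: ir; rewrite -ji jr.
rewrite meanD// !ih ?addr0//; last by apply: step.
by move=> zeta; rewrite -mulNr; apply: step; rewrite abszN.
Qed.

(** If some frequency is nonzero, both sides vanish; otherwise every factor is constant. *)
Lemma mean_prod_trigmon n (p : 'I_n -> int) (x : 'I_n -> R * int * R) (M : nat) :
  nonresonant M p -> (forall i, (`|(x i).1.2| <= M)%N) ->
  mean P (fun t : T => \prod_(i < n) trigmon (x i) ((p i)%:~R * t)) =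
  \prod_(i < n) mean P (trigmon (x i)).
Proof.
move=> pM xM.
have [/existsP[i xi0]|/existsPn/= x0] := boolP [exists i, (x i).1.2 != 0].
  have xi : mean P (trigmon (x i)) = 0.
    by move: xi0; case: (x i) => -[b k] d /= /negbTE k0; rewrite mean_trigmon k0.
  rewrite [RHS](bigD1 i)//= xi mul0r.
  rewrite -[RHS](@mean_prod_trigmon_eq0 _ (index_enum _) x p 1 0 0).
  - congr mean; apply/funext => t.
    by rewrite [trigmon (1, 0, 0) t]/trigmon/= mul0r mulr0 addr0 cos0 !mul1r.
  - exact: index_enum_uniq.
  - move=> zeta hz; rewrite add0r; apply: pM; first by move=> j; rewrite hz.
    by exists i; rewrite -absz_eq0 hz absz_eq0.
rewrite -[RHS](mean_cst P); congr mean; apply/funext => t.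
apply: eq_bigr => i _; move: (x0 i); rewrite negbK.
case: (x i) => -[a k] c /= /eqP ->.
by rewrite mean_trigmon eqxx /trigmon/= mul0r mulr0 add0r.
Qed.

(** Padding with the zero monomial gives all sums the common index type ['I_K], over which
    [bigA_distr_bigA] can distribute a product. *)
Lemma trigsum_nth (s : seq (R * int * R)) (K : nat) t : (size s <= K)%N ->
  trigsum s t = \sum_(k < K) trigmon (nth (0, 0, 0) s k) t.
Proof.
move=> sK; rewrite /trigsum (big_nth (0, 0, 0)) -(big_mkord xpredT (fun k =>
  trigmon (nth (0, 0, 0) s k) t)) (@big_cat_nat _ _ _ (size s) 0 K)//=.
rewrite [X in _ = _ + X]big_nat_cond [X in _ = _ + X]big1 ?addr0//.
by move=> k /andP[/andP[sk _] _]; rewrite nth_default// /trigmon/= mul0r.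
Qed.

Lemma mean_prod_trigpoly n (f : 'I_n -> R -> R) : (forall i, trigpoly (f i)) ->
  exists M : nat, forall p : 'I_n -> int, nonresonant M p ->
    mean P (fun t : T => \prod_(i < n) f i ((p i)%:~R * t)) =
    \prod_(i < n) mean P (f i).
Proof.
move=> /choice[s fs].
pose K := \max_(i < n) size (s i).
pose x i k := nth (0, 0, 0) (s i) k.
pose M := \max_(i < n) \max_(k < K) `|(x i k).1.2|%N.
have fE i t : f i t = \sum_(k < K) trigmon (x i k) t.
  rewrite fs (@trigsum_nth _ K)//.
  exact: (@leq_bigmax_cond _ xpredT (fun i => size (s i))).
have bx i : @bounded_measurable _ T R (trigmon i).
  exact/trigpoly_bounded_measurable/trigpoly_mon.
exists M => p pM.
under eq_fun do (under eq_bigr do rewrite fE; rewrite bigA_distr_bigA/=).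
have -> : \prod_(i < n) mean P (f i) =
    \prod_(i < n) \sum_(k < K) mean P (trigmon (x i k)).
  apply: eq_bigr => i _; rewrite -mean_sum//.
  by congr mean; apply/funext => t; rewrite fE.
rewrite bigA_distr_bigA/= mean_sum; last first.
  move=> h; apply: bounded_measurable_prod => i.
  exact/trigpoly_bounded_measurable/trigpoly_dilate/trigpoly_mon.
apply: eq_bigr => h _; apply: (mean_prod_trigmon pM) => i.
apply: leq_trans (leq_bigmax_cond _ (isT : xpredT i)).
exact: (@leq_bigmax_cond _ xpredT (fun k : 'I_K => `|(x i k).1.2|%N)).
Qed.

(** The case of a single factor: one nonzero integer is nonresonant for every bound. *)
Lemma mean_trigpoly_dilate f (p : int) : trigpoly f -> p != 0 ->
  mean P (fun t : T => f (p%:~R * t)) = mean P f.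
Proof.
move=> tf p0.
have [M /(_ (fun=> p))] := @mean_prod_trigpoly 1 (fun=> f) (fun=> tf).
rewrite big_ord1 => <-.
  by congr mean; apply/funext => t; rewrite big_ord1.
by move=> zeta _ [j]; rewrite big_ord1 (ord1 j) => z0; rewrite mulf_neq0.
Qed.

End independence.

(** * Powers converging to a step function *)

Section urysohn_power.
Variable R : realType.
Implicit Types x y q r : R.

Lemma bernoulli_ge y N : 0 <= y <= 1 -> 1 - N%:R * y <= (1 - y) ^+ N.
Proof.
move=> /andP[y0 y1]; elim: N => [|N ih]; first by rewrite mul0r subr0 expr0.
rewrite exprS; apply: (@le_trans _ _ ((1 - y) * (1 - N%:R * y))).
  rewrite -natr1; have : 0 <= N%:R * y ^+ 2 by rewrite mulr_ge0// sqr_ge0.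
  by nra.
by apply: ler_wpM2l => //; rewrite subr_ge0.
Qed.

(** A division-free form of the upper bound [1 / (1 + N y)], which is small once [N y] is large. *)
Lemma bernoulli_le y N : 0 <= y <= 1 -> (1 - y) ^+ N * (1 + N%:R * y) <= 1.
Proof.
move=> /andP[y0 y1]; elim: N => [|N ih]; first by rewrite mul0r addr0 expr0 mulr1.
apply: le_trans ih; rewrite exprSr -mulrA; apply: ler_wpM2l.
  by rewrite exprn_ge0// subr_ge0.
rewrite -natr1; have : 0 <= N%:R * y ^+ 2 by rewrite mulr_ge0// sqr_ge0.
have : 0 <= y ^+ 2 by rewrite sqr_ge0.
by nra.
Qed.

Lemma cvg_natM_expr q : 0 <= q < 1 -> (fun n => n%:R * q ^+ n) @ \oo --> (0 : R).
Proof.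
(* With [r = sqrt q], one has [n q^n = (n r^n) r^n], and [bernoulli_le] at [y = 1 - r] bounds
   [n r^n] by [1 / (1 - r)]. *)
move=> /andP[q0 q1]; set r := Num.sqrt q.
have r0 : 0 <= r by exact: sqrtr_ge0.
have r1 : r < 1 by rewrite -sqrtr1 ltr_sqrt.
have rn : (fun n => r ^+ n * (1 - r)^-1) @ \oo --> (0 : R).
  rewrite -[X in _ --> X](mul0r (1 - r)^-1); apply: cvgMl.
  by apply: cvg_expr; rewrite ger0_norm.
apply: (squeeze_cvgr _ (cvg_cst 0) rn); near=> n.
rewrite mulr_ge0 ?exprn_ge0//= ler_pdivlMr ?subr_gt0//.
have r01 : 0 <= 1 - r <= 1 by rewrite subr_ge0 (ltW r1) lerBlDr lerDl.
have := ler_wpM2l (exprn_ge0 n r0) (bernoulli_le n r01).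
rewrite subKr -(sqr_sqrtr q0) -/r -exprM mulnC exprM.
have := exprn_ge0 n r0; move: (r ^+ n) => X X0.
have := sqr_ge0 X; by lra.
Unshelve. all: by end_near. Qed.

(* The exponents [n] and [n k^n] are those of Brosowski and Deutsch's proof of
   the Stone-Weierstrass theorem, where the second one is [k^n]; the extra
   factor [n] makes the limit exist, and vanish, at [x = 1/k] as well. *)
Lemma cvg_urysohn_power x k : 0 <= x <= 1 ->
  (fun n => (1 - x ^+ n) ^+ (n * k ^ n)) @ \oo --> ((k%:R * x < 1)%R%:R : R).
Proof.
move=> /andP[x0 x1].
have xn n : 0 <= x ^+ n <= 1 by rewrite exprn_ge0// exprn_ile1.
have NE n : (n * k ^ n)%:R * x ^+ n = n%:R * (k%:R * x) ^+ n :> R.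
  by rewrite natrM natrX exprMn mulrA.
(* Let [N = n k^n], so that [N x^n = n (k x)^n]. If [k x < 1], this tends to 0 and the power is at
   least [1 - N x^n]; otherwise it is at least [n] and the power is at most [1 / (n + 1)]. *)
have [kx|kx] := ltP (k%:R * x) 1.
  have h : (fun n => 1 - n%:R * (k%:R * x) ^+ n) @ \oo --> (1 : R).
    rewrite -[X in _ --> X]subr0; apply: cvgB; first exact: cvg_cst.
    by apply: cvg_natM_expr; rewrite kx mulr_ge0.
  apply: (squeeze_cvgr _ h (cvg_cst (1 : R))); near=> n.
  have /andP[a b] := xn n.
  by rewrite -NE bernoulli_ge//= exprn_ile1// ?subr_ge0// lerBlDr lerDl.
have h : (fun n : nat => harmonic n : R) @ \oo --> (0 : R) by exact: cvg_harmonic.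
apply: (squeeze_cvgr _ (cvg_cst (0 : R)) h); near=> n.
have /andP[a b] := xn n.
have u0 : 0 <= (1 - x ^+ n) ^+ (n * k ^ n) by rewrite exprn_ge0// subr_ge0.
rewrite u0/= -[leRHS]mul1r ler_pdivlMr//.
apply: le_trans (bernoulli_le (n * k ^ n) (xn n)).
apply: ler_wpM2l => //; rewrite NE -natr1 addrC lerD2l ler_peMr//.
by rewrite exprn_ege1.
Unshelve. all: by end_near. Qed.

End urysohn_power.

(** * Functions approximable in mean square by trigonometric polynomials *)

Section approximable.
Variable R : realType.
Local Notation P := (uniform_prob (@ltr01 R)).
Local Notation T := (measurableTypeR R).
Variable q : bool -> int.

Definition unit_valued (f : R -> R) := forall t, 0 <= f t <= 1.

Definition sqdist (k : int) (f g : R -> R) :=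
  mean P (fun t : T => (f (k%:~R * t) - g (k%:~R * t)) ^+ 2).

(* One [g] must serve for both dilations [q true] and [q false]: applied with
   the values 1 and p, this is what compares L^2 errors at [t] and at [p t]. *)
Definition approximable (f : R -> R) := [/\ measurable_fun [set: T] f,
  unit_valued f & forall e : R, 0 < e -> exists g,
    [/\ trigpoly g, unit_valued g & forall b, sqdist (q b) f g < e]].

Lemma unit_bounded_measurable f : measurable_fun [set: T] f -> unit_valued f ->
  @bounded_measurable _ T R f.
Proof.
by move=> mf f01; split=> //; exists 1 => t; have /andP[? ?] := f01 t; rewrite ger0_norm.
Qed.

Lemma dilate_bounded_measurable (k : int) f : @bounded_measurable _ T R f ->
  @bounded_measurable _ T R (fun t => f (k%:~R * t)).
Proof.
move=> [mf [M fM]]; split; last by exists M.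
have mk : measurable_fun [set: T] (fun t : T => k%:~R * t : T).
  exact: measurable_funM.
exact: (measurableT_comp mf mk).
Qed.

Lemma sqdist_bounded_measurable k f g : @bounded_measurable _ T R f ->
  @bounded_measurable _ T R g ->
  @bounded_measurable _ T R (fun t => (f (k%:~R * t) - g (k%:~R * t)) ^+ 2).
Proof.
move=> bf bg; apply: bounded_measurableX.
by apply: bounded_measurableB; exact: dilate_bounded_measurable.
Qed.

(** Rests on [(y + z)^2 <= 2 y^2 + 2 z^2]; it replaces the triangle inequality of L^2 while keeping
    squared distances. *)
Lemma sqdist_le2 k f g f' g' f'' g'' :
  @bounded_measurable _ T R f -> @bounded_measurable _ T R g ->
  @bounded_measurable _ T R f' -> @bounded_measurable _ T R g' ->
  @bounded_measurable _ T R f'' -> @bounded_measurable _ T R g'' ->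
  (forall t, `|f t - g t| <= `|f' t - g' t| + `|f'' t - g'' t|) ->
  sqdist k f g <= 2 * sqdist k f' g' + 2 * sqdist k f'' g''.
Proof.
move=> bf bg bf' bg' bf'' bg'' H.
have b0 := sqdist_bounded_measurable k bf bg.
have b1 := sqdist_bounded_measurable k bf' bg'.
have b2 := sqdist_bounded_measurable k bf'' bg''.
rewrite /sqdist -!meanZ// -meanD; try exact: bounded_measurableZ.
apply: le_mean => //.
  by apply: bounded_measurableD; exact: bounded_measurableZ.
move=> t; set u := k%:~R * t.
rewrite -real_normK ?num_real// -[X in _ <= _ * X + _]real_normK ?num_real//.
rewrite -[X in _ <= _ + _ * X]real_normK ?num_real//.
move: (H u) (normr_ge0 (f u - g u)) (normr_ge0 (f' u - g' u)).
move: (normr_ge0 (f'' u - g'' u)) (sqr_ge0 (`|f' u - g' u| - `|f'' u - g'' u|)).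
move: `|f u - g u| `|f' u - g' u| `|f'' u - g'' u| => x y z.
move=> z0 yz xyz x0 y0.
apply: (@le_trans _ _ ((y + z) ^+ 2)); first by rewrite ler_sqr ?nnegrE ?addr_ge0.
by nra.
Qed.

Lemma approximable_trig f : trigpoly f -> unit_valued f -> approximable f.
Proof.
move=> tf f01; split => //; first by case: (trigpoly_bounded_measurable tf).
move=> e e0; exists f; split => // b.
rewrite /sqdist (_ : (fun _ => _) = fun=> 0) ?mean_cst//.
by apply/funext => t; rewrite subrr expr0n.
Qed.

Lemma unit_valuedM f g : unit_valued f -> unit_valued g ->
  unit_valued (fun t => f t * g t).
Proof.
move=> f01 g01 t; have /andP[? ?] := f01 t; have /andP[? ?] := g01 t.
by rewrite mulr_ge0//= mulr_ile1.
Qed.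

Lemma unit_valued_onem f : unit_valued f -> unit_valued (fun t => 1 - f t).
Proof.
by move=> f01 t; have /andP[? ?] := f01 t; rewrite subr_ge0 lerBlDr lerDl; apply/andP.
Qed.

Lemma approximable_bounded f : approximable f -> @bounded_measurable _ T R f.
Proof. by move=> [mf f01 _]; exact: unit_bounded_measurable. Qed.

Lemma approximableM f g : approximable f -> approximable g ->
  approximable (fun t => f t * g t).
Proof.
move=> af ag; have bf := approximable_bounded af; have bg := approximable_bounded ag.
case: af ag => mf f01 af [mg g01 ag]; split.
- exact: measurable_funM.
- exact: unit_valuedM.
move=> e e0; have e4 : 0 < e / 4 by rewrite divr_gt0.
have [f' [tf' f'01 ff']] := af _ e4; have [g' [tg' g'01 gg']] := ag _ e4.
exists (fun t => f' t * g' t); split.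
- exact: trigpolyM.
- exact: unit_valuedM.
move=> b; apply: (@le_lt_trans _ _ (2 * sqdist (q b) f f' + 2 * sqdist (q b) g g')).
  have bf' := trigpoly_bounded_measurable tf'.
  have bg' := trigpoly_bounded_measurable tg'.
  apply: sqdist_le2 => //; try exact: bounded_measurableM.
  move=> t.
  rewrite (_ : _ - _ = (f t - f' t) * g t + f' t * (g t - g' t)); last by ring.
  apply: (le_trans (ler_normD _ _)); rewrite !normrM.
  have /andP[? ?] := g01 t; have /andP[? ?] := f'01 t.
  by apply: lerD; [rewrite ler_piMr// ger0_norm | rewrite ler_piMl// ger0_norm].
have := ff' b; have := gg' b; by lra.
Qed.

Lemma approximable_onem f : approximable f -> approximable (fun t => 1 - f t).
Proof.
move=> [mf f01 af]; split.
- by apply: measurable_funB.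
- exact: unit_valued_onem.
move=> e /af[g [tg g01 fg]]; exists (fun t => 1 - g t); split.
- by apply: trigpolyB => //; exact: trigpoly_cst.
- exact: unit_valued_onem.
move=> b; have := fg b; congr (_ < _); congr mean; apply/funext => t.
by ring.
Qed.

Lemma approximable_prod I (r : seq I) (F : I -> R -> R) :
  (forall i, approximable (F i)) -> approximable (fun t => \prod_(i <- r) F i t).
Proof.
move=> aF; elim: r => [|i r ih].
  under eq_fun do rewrite big_nil; apply: approximable_trig.
    exact: trigpoly_cst.
  by move=> t; rewrite ler01 lexx.
by under eq_fun do rewrite big_cons; exact: approximableM.
Qed.

(** Dominated convergence applies to each of the two dilations, so a single [F n] is close to [f]
    under both, and an approximant of this [F n] serves for [f]. *)
Lemma approximable_lim (F : nat -> R -> R) f : (forall n, approximable (F n)) ->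
  (forall t, F n t @[n --> \oo] --> f t) -> approximable f.
Proof.
move=> aF Ff; have bF n := approximable_bounded (aF n).
have f01 : unit_valued f.
  move=> t; have cF : cvgn (F ^~ t) by apply/cvg_ex; eexists; exact: Ff.
  rewrite -(cvg_lim _ (Ff t))//; apply/andP; split.
    by apply: limr_ge => //; apply: nearW => n; case: (aF n) => _ /(_ t)/andP[].
  by apply: limr_le => //; apply: nearW => n; case: (aF n) => _ /(_ t)/andP[].
have mf : measurable_fun [set: T] f.
  apply: (@measurable_fun_cvg _ _ _ _ F); last by move=> t _; exact: Ff.
  by move=> n; case: (aF n).
have bf := unit_bounded_measurable mf f01.
split => // e e0; have e4 : 0 < e / 4 by rewrite divr_gt0.
have close b : \forall n \near \oo, sqdist (q b) f (F n) < e / 4.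
  have h : sqdist (q b) f (F n) @[n --> \oo] --> mean P (fun=> 0).
    apply: (@mean_dominated_cvg _ _ _ P _ _ 1).
    - by move=> n; case: (sqdist_bounded_measurable (q b) bf (bF n)).
    - move=> n t; set u := _ * t; have [_ /(_ u) /andP[? ?] _] := aF n.
      have /andP[? ?] := f01 u.
      rewrite normrX exprn_ile1// ler_norml; apply/andP; split; by lra.
    - move=> t; set u := _ * t.
      have h : f u - F n u @[n --> \oo] --> f u - f u.
        apply: (@cvgB _ _ _ _ _ (fun=> f u) (F ^~ u)); last exact: Ff.
        exact: cvg_cst.
      by rewrite subrr in h; have := cvgM h h; rewrite mulr0; exact.
  rewrite mean_cst in h; move/cvgrPdist_lt : h => /(_ _ e4).
  by apply: filterS => n; rewrite sub0r normrN; apply: le_lt_trans; exact: ler_norm.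
have [n [nt nf]] : exists n, sqdist (q true) f (F n) < e / 4 /\
    sqdist (q false) f (F n) < e / 4.
  near \oo => n; exists n; split; near: n; exact: close.
have [_ _ /(_ _ e4)[g [tg g01 Fg]]] := aF n.
exists g; split => // b.
have fb : sqdist (q b) f (F n) < e / 4 by case: b.
apply: (@le_lt_trans _ _ (2 * sqdist (q b) f (F n) + 2 * sqdist (q b) (F n) g)).
  have bg := trigpoly_bounded_measurable tg.
  apply: sqdist_le2 => // t.
  by rewrite (_ : f t - g t = (f t - F n t) + (F n t - g t)) ?ler_normD//; ring.
by have := Fg b; lra.
Unshelve. all: by end_near. Qed.

Lemma approximable_indic_setC (A : set R) :
  approximable (\1_A) -> approximable (\1_(~` A)).
Proof.
move=> /approximable_onem; congr approximable; apply/funext => t.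
by rewrite !indicE in_setC; case: (t \in A); rewrite /= ?subrr ?subr0.
Qed.

(** Finite unions are obtained from complements and products; at each point their indicators are
    eventually constant. *)
Lemma approximable_indic_bigcup (A : nat -> set R) :
  (forall n, approximable (\1_(A n))) -> approximable (\1_(\bigcup_n A n)).
Proof.
move=> aA.
pose F n (t : R) : R := 1 - \prod_(i < n) (1 - \1_(A i) t).
apply: (@approximable_lim F).
  move=> n; apply: approximable_onem.
  by apply: (approximable_prod (index_enum 'I_n)) => i; exact: approximable_onem.
move=> t; rewrite indicE; have [|tA] := boolP (t \in _).
  rewrite inE => -[n _ Ant].
  apply: cvg_near_cst; exists n.+1 => // m /= nm.
  rewrite /F (bigD1 (Ordinal nm))//= indicE mem_set//= subrr mul0r subr0//.
apply: cvg_near_cst; apply: nearW => m.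
rewrite /F big1 ?subrr// => i _; rewrite indicE memNset/= ?subr0//.
by move=> Ait; move: tA; rewrite notin_setE; apply; exists i.
Qed.

Lemma approximable_indic0 : approximable (\1_set0).
Proof.
rewrite (_ : \1_set0 = fun=> 0); last by apply/funext => t; rewrite indicE in_set0.
by apply: approximable_trig; [exact: trigpoly_cst | move=> t; rewrite lexx ler01].
Qed.

(* [halfchord s t] is [sin^2 (pi (t - s))], a quarter of the squared distance
   between the points of the circle with parameters [s] and [t]. *)
Definition halfchord (s t : R) : R := 2^-1 - 2^-1 * cos (pi *+ 2 * t - pi *+ 2 * s).

Lemma unit_valued_halfchord s : unit_valued (halfchord s).
Proof.
move=> t; rewrite /halfchord; have := cos_le1 (pi *+ 2 * t - pi *+ 2 * s).
by have := cos_geN1 (pi *+ 2 * t - pi *+ 2 * s) => ? ?; apply/andP; split; lra.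
Qed.

Lemma trigpoly_halfchord s : trigpoly (halfchord s).
Proof.
rewrite (_ : halfchord s = fun t => 2^-1 - trigmon (2^-1, 1, - (pi *+ 2 * s)) t).
  by apply: trigpolyB; [exact: trigpoly_cst | exact: trigpoly_mon].
by apply/funext => t; rewrite /trigmon/= mul1r.
Qed.

(** This is [cvg_urysohn_power] at [x = halfchord s t]: the powers there are again trigonometric
    polynomials with values in [0, 1]. *)
Lemma approximable_halfchord s k :
  approximable (\1_([set t | k%:R * halfchord s t < 1])).
Proof.
pose F n (t : R) := (1 - halfchord s t ^+ n) ^+ (n * k ^ n).
apply: (@approximable_lim F).
  move=> n; apply: approximable_trig.
    apply/trigpolyX/trigpolyB; first exact: trigpoly_cst.
    exact/trigpolyX/trigpoly_halfchord.
  move=> t; have /andP[a b] := unit_valued_halfchord s t.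
  have := exprn_ge0 n a; have := exprn_ile1 n a b => ? ?.
  by rewrite /F exprn_ge0 ?subr_ge0//= exprn_ile1// ?subr_ge0// lerBlDr lerDl.
move=> t; rewrite indicE.
rewrite (_ : t \in _ = (k%:R * halfchord s t < 1)); last first.
  by apply/idP/idP; rewrite inE.
exact/cvg_urysohn_power/unit_valued_halfchord.
Qed.

End approximable.

(** * Approximation of indicators of Borel sets *)

Section borel_approximation.
Variable R : realType.
Local Notation P := (uniform_prob (@ltr01 R)).
Local Notation T := (measurableTypeR R).
Local Open Scope complex_scope.

Lemma normE_normc (z : R[i]) : `|z| = (normc z)%:C.
Proof. by case: z. Qed.

Lemma normc_ge0 (z : R[i]) : 0 <= normc z.
Proof. by case: z => a b; exact: sqrtr_ge0. Qed.

Lemma normc_cexpB_sqr (s t : R) :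
  normc ((cexp t : R[i]) - cexp s) ^+ 2 = 4 * halfchord s t.
Proof.
rewrite /halfchord cosB /cexp /normc /= sqr_sqrtr; last first.
  by rewrite addr_ge0// sqr_ge0.
have := cos2Dsin2 (pi *+ 2 * t); have := cos2Dsin2 (pi *+ 2 * s).
by move=> h1 h2; lra.
Qed.

Lemma halfchord_close (t : R) (e : R) : 0 < e ->
  exists s : rat, halfchord (ratr s) t < e.
Proof.
move=> e0.
have ch : continuous (fun s => halfchord s t).
  rewrite (_ : (fun s => _) =
      fun s : R => 2^-1 - 2^-1 * cos (- (pi *+ 2) * s + pi *+ 2 * t)).
    move=> s; apply: cvgB; first exact: cvg_cst.
    by apply: cvgM; [exact: cvg_cst | exact: continuous_cos_linear].
  by apply/funext => s; rewrite /halfchord mulNr [- _ + _]addrC.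
have oU : open [set s | halfchord s t < e].
  by apply: (@open_comp _ _ (fun s => halfchord s t) [set x | x < e]) => //;
    exact: open_lt.
have [y [/= ste [r _ rs]]] : [set s | halfchord s t < e] `&` range (@ratr R) !=set0.
  apply: dense_rat => //; exists t.
  by rewrite /= /halfchord subrr cos0 mulr1 subrr.
by exists r; rewrite rs.
Qed.

Lemma approximable_open q (U : set R[i]^o) : open U ->
  approximable q (\1_(@cexp R @^-1` U)).
Proof.
move=> oU.
(* [D (n, s)] is the arc of chordal radius [2 / sqrt (n + 2)] about the point of rational parameter
   [s]. The pairs [(n, s)] are countable, and [B] keeps the arcs contained in [U]. *)
pose D (x : nat * rat) := [set t : R | x.1.+2%:R * halfchord (ratr x.2) t < 1].
pose B k := if (choice.unpickle k : option (nat * rat)) is Some x then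
  (if `[< D x `<=` @cexp R @^-1` U >] then D x else set0) else set0.
have -> : @cexp R @^-1` U = \bigcup_k B k.
  apply/seteqP; split=> [t Ut|t [k _]]; last first.
    rewrite /B; case: (choice.unpickle k) => // x.
    by case: asboolP => // DU; exact: DU.
  have : nbhs (cexp t : R[i]^o) U by apply: open_nbhs_nbhs; split.
  move=> /nbhs_ballP[e /= e0 eU].
  have [r r0 er] : exists2 r : R, 0 < r & e = r%:C.
    case: e e0 {eU} => a b; rewrite ltcE/= => /andP[/eqP -> a0].
    by exists a.
  (* Above [16 / r^2] one gets [4 / (n + 2) < r^2 / 4]: two points of [D (n, s)] are each within
     [r / 2] of its centre, hence within [r] of each other. *)
  have [n n16] : exists n : nat, 16 / r ^+ 2 < n%:R.
    exists (Num.truncn (16 / r ^+ 2)).+1; exact: truncnS_gt.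
  have n2 : 16 < r ^+ 2 * n.+2%:R.
    move: n16; rewrite ltr_pdivrMr ?exprn_gt0// mulrC => /lt_le_trans; apply.
    by apply: ler_wpM2l; [exact: sqr_ge0 | rewrite ler_nat; lia].
  have [s st] : exists s : rat, halfchord (ratr s) t < n.+2%:R^-1.
    by apply: halfchord_close; rewrite invr_gt0.
  have nD u : D (n, s) u -> normc ((cexp u : R[i]) - cexp (ratr s : R)) < r / 2.
    rewrite /D/= => Du.
    rewrite -(@ltr_pXn2r _ 2)// ?nnegrE ?normc_ge0 ?divr_ge0// ?(ltW r0)//.
    rewrite normc_cexpB_sqr expr_div_n.
    have n0 : 0 < n.+2%:R :> R by [].
    have : n.+2%:R * (r ^+ 2) / 16 > 1 by rewrite ltr_pdivlMr// mul1r mulrC.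
    move=> h; have {}h : n.+2%:R * halfchord (ratr s) u < n.+2%:R * (r ^+ 2 / 16).
      by apply: (lt_trans Du); rewrite mulrA.
    by move: h; rewrite ltr_pM2l// => h; lra.
  have Dt : D (n, s) t by rewrite /D/= mulrC -ltr_pdivlMr// mul1r.
  exists (choice.pickle (n, s)) => //; rewrite /B choice.pickleK.
  case: asboolP => // -[] u Du; apply: eU; rewrite -ball_normE/= er normE_normc ltcR.
  rewrite (_ : _ - _ = ((cexp t : R[i]) - cexp (ratr s : R)) -
    ((cexp u : R[i]) - cexp (ratr s : R))); last by ring.
  apply: (le_lt_trans (le_normcD _ _)); rewrite normcN.
  by rewrite [ltRHS]splitr; apply: ltrD; exact: nD.
apply: approximable_indic_bigcup => k; rewrite /B.
case: (choice.unpickle k) => [x|]; last exact: approximable_indic0.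
by case: asboolP => _; [exact: approximable_halfchord | exact: approximable_indic0].
Qed.

(** The sets whose preimage has an approximable indicator form a sigma-algebra, which contains the
    open sets. *)
Lemma approximable_borel q (A : set (borelC R)) : measurable A ->
  approximable q (\1_(@cexp R @^-1` A)).
Proof.
move=> mA; pose G := [set A : set (borelC R) | approximable q (\1_(@cexp R @^-1` A))].
suff : <<s (@open R[i]^o) >> `<=` G by apply.
apply: smallest_sub; last by move=> U oU; exact: approximable_open.
split.
- by rewrite /G/= preimage_set0; exact: approximable_indic0.
- by move=> B GB; rewrite /G/= setTD preimage_setC; exact: approximable_indic_setC.
- by move=> F GF; rewrite /G/= preimage_bigcup; exact: approximable_indic_bigcup.
Qed.

Lemma sqdist_sym k (f g : R -> R) : sqdist k f g = sqdist k g f.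
Proof. by congr mean; apply/funext => t; rewrite -sqrrN opprB. Qed.

Lemma sqdist_triangle k (f g h : R -> R) : @bounded_measurable _ T R f ->
  @bounded_measurable _ T R g -> @bounded_measurable _ T R h ->
  sqdist k f g <= 2 * sqdist k f h + 2 * sqdist k h g.
Proof.
move=> bf bg bh; apply: sqdist_le2 => // t.
by rewrite (_ : f t - g t = (f t - h t) + (h t - g t)) ?ler_normD//; ring.
Qed.

(* [t |-> p t mod 1] preserves the uniform measure; only this consequence of
   the equality of Fourier coefficients is needed. *)
Lemma sqdist_dilate (A : set (borelC R)) g (p : int) : measurable A ->
  trigpoly g -> p != 0 ->
  sqdist p (\1_(@cexp R @^-1` A)) g <= 4 * sqdist 1 (\1_(@cexp R @^-1` A)) g.
Proof.
move=> mA tg p0; set f := \1_ _; apply/ler_addgt0Pr => e e0.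
pose q (b : bool) : int := if b then 1 else p.
have af : approximable q f by exact: approximable_borel.
have bf := approximable_bounded af; have bg := trigpoly_bounded_measurable tg.
(* The error of [h] enters twice at dilation [p] and four times at dilation 1, hence [e / 6]. *)
case: af => _ _ /(_ (e / 6))[|h [th _ fh]]; first by rewrite divr_gt0.
have bh := trigpoly_bounded_measurable th.
have E : sqdist p h g = sqdist 1 h g.
  have tq : trigpoly (fun t => (h t - g t) ^+ 2) by exact/trigpolyX/trigpolyB.
  by rewrite /sqdist (mean_trigpoly_dilate tq p0) (mean_trigpoly_dilate tq).
have := sqdist_triangle p bf bg bh; rewrite E.
have := sqdist_triangle 1 bh bg bf; rewrite [sqdist 1 h f]sqdist_sym.
have := fh true; have := fh false; rewrite /q; by lra.
Qed.

End borel_approximation.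

(** * Linear relations far out in E *)

Section cofinitely.

(** Convertible with the conclusions of [pseudo_independent] and [I_infty], so that the lemmas below
    apply to both. *)
Definition cofinitely (E : set int) n (Q : ('I_n -> int) -> Prop) : Prop :=
  exists G : set int, [/\ finite_set G, G `<=` E &
    forall p : 'I_n -> int, injective p -> (forall i, (E `\` G) (p i)) -> Q p].

Lemma cofinitely_sub E n (Q Q' : ('I_n -> int) -> Prop) :
  (forall p, injective p -> (forall i, E (p i)) -> Q p -> Q' p) ->
  cofinitely E Q -> cofinitely E Q'.
Proof.
move=> QQ' [G [fG GE GQ]]; exists G; split => // p ip Ep.
by apply: QQ' => //; [move=> i; case: (Ep i) | exact: GQ].
Qed.

Lemma cofinitely_forall E n (J : finType) (Q : J -> ('I_n -> int) -> Prop) :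
  (forall j, cofinitely E (Q j)) -> cofinitely E (fun p => forall j, Q j p).
Proof.
move=> /choice[G GQ]; exists (\bigcup_j G j); split.
- by apply: bigcup_finite => [|j _]; [exact: finite_finset | case: (GQ j)].
- by apply: bigcup_sub => j _; case: (GQ j).
- move=> p ip pE j; case: (GQ j) => _ _; apply=> // i.
  by have [? nG] := pE i; split => // Gj; apply: nG; exists j.
Qed.

Lemma cofinitely_comp E k n (f : 'I_k -> 'I_n) (Q : ('I_k -> int) -> Prop) :
  injective f -> cofinitely E Q -> cofinitely E (fun p => Q (p \o f)).
Proof.
move=> If [G [fG GE GQ]]; exists G; split => // p ip Ep.
by apply: GQ => [|i]; [exact: inj_comp | exact: Ep].
Qed.

(* If [r] and [r'] are disjoint solutions of [\sum_i zeta i * r i = 0], then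
   [(r, r')] is a solution for [(zeta, - zeta)], whose sum vanishes. *)
Lemma I_infty_nonzero E k (zeta : 'I_k -> int) : I_infty E -> (0 < k)%N ->
  (forall i, zeta i != 0) ->
  cofinitely E (fun r => \sum_(i < k) zeta i * r i != 0).
Proof.
move=> IE k0 z0.
pose zz (i : 'I_(k + k)) :=
  match fintype.split i with inl j => zeta j | inr j => - zeta j end.
have zzl j : zz (lshift k j) = zeta j by rewrite /zz (fintype.unsplitK (inl j)).
have zzr j : zz (rshift k j) = - zeta j by rewrite /zz (fintype.unsplitK (inr j)).
have [] := IE _ zz.
- by rewrite addn_gt0 k0.
- by move=> i; rewrite /zz; case: fintype.split => j; rewrite ?oppr_eq0.
- rewrite big_split_ord/=; under eq_bigr do rewrite zzl.
  by under [X in _ + X]eq_bigr do rewrite zzr; rewrite sumrN subrr.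
move=> G [fG GE HG].
have [[r [ir Er r0]]|no] := pselect (exists r : 'I_k -> int,
    [/\ injective r, (forall i, (E `\` G) (r i)) &
     \sum_(i < k) zeta i * r i = 0]); last first.
  exists G; split => // r ir Er; apply/eqP => r0.
  by apply: no; exists r.
(* Once the values of [r] are excluded too, any further solution is disjoint from [r]. *)
exists (G `|` range r); split.
- by rewrite finite_setU; split => //; apply: finite_image; exact: finite_finset.
- by move=> x [/GE//|[j _ <-]]; case: (Er j).
move=> r' ir' Er'; apply/eqP => r'0.
pose rr (i : 'I_(k + k)) := match fintype.split i with inl j => r j | inr j => r' j end.
have rrl j : rr (lshift k j) = r j by rewrite /rr (fintype.unsplitK (inl j)).
have rrr j : rr (rshift k j) = r' j by rewrite /rr (fintype.unsplitK (inr j)).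
have rr' i j : r i <> r' j.
  by move=> rij; case: (Er' j) => _; apply; right; exists i.
have S0 : \sum_i zz i * rr i = 0.
  rewrite big_split_ord/=; under eq_bigr do rewrite zzl rrl.
  under [X in _ + X]eq_bigr do rewrite zzr rrr mulNr.
  by rewrite sumrN r0 r'0 subrr.
suff : false by []; move: (HG rr); rewrite S0 eqxx; apply.
- move=> i j; rewrite -(fintype.splitK i) -(fintype.splitK j).
  case: (fintype.split i) => i'; case: (fintype.split j) => j';
    rewrite /fintype.unsplit ?rrl ?rrr.
  + by move=> /ir ->.
  + by move=> /rr'.
  + by move=> /esym/rr'.
  + by move=> /ir' ->.
- move=> i; rewrite /rr; case: fintype.split => j; first exact: Er.
  by have [? ng] := Er' j; split => // Gj; apply: ng; left.
Qed.

(** Zero coefficients drop out of the sum, which reduces the claim to [I_infty_nonzero] on the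
    support [S]. *)
Lemma I_infty_nontrivial E n (zeta : 'I_n -> int) : I_infty E ->
  (exists i, zeta i != 0) ->
  cofinitely E (fun p => \sum_(i < n) zeta i * p i != 0).
Proof.
move=> IE [i0 zi0]; pose S := [set i | zeta i != 0]%SET.
have S0 : (0 < #|S|)%N by apply/card_gt0P; exists i0; rewrite inE.
have zS (j : 'I_#|S|) : zeta (enum_val j) != 0.
  by have := enum_valP j; rewrite inE.
have := cofinitely_comp enum_val_inj (I_infty_nonzero IE S0 zS).
apply: cofinitely_sub => p _ _ /=.
rewrite -(big_enum_val (fun i => zeta i * p i))/= big_mkcond/=.
congr (_ != _); apply: eq_bigr => i _; rewrite inE.
by case: eqP => //= ->; rewrite mul0r.
Qed.

Lemma I_infty_nonresonant E M n : I_infty E -> cofinitely E (@nonresonant M n).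
Proof.
move=> IE.
(* Only finitely many coefficient vectors are bounded by [M]; shifting by [M] encodes them as
   functions into ['I_(M + M).+1], and [cofinitely_forall] applies. *)
pose z (h : {ffun 'I_n -> 'I_(M + M).+1}) i : int := (h i)%:Z - M%:Z.
have : cofinitely E (fun p => forall h, (exists i, z h i != 0) ->
    \sum_(i < n) z h i * p i != 0).
  apply: cofinitely_forall => h.
  have [zh|zh] := pselect (exists i, z h i != 0).
    by apply: cofinitely_sub (I_infty_nontrivial IE zh).
  by exists set0; split.
apply: cofinitely_sub => p _ _ H zeta zM z0.
pose h := [ffun i => inord (absz (zeta i + M%:Z)) : 'I_(M + M).+1].
have zE i : z h i = zeta i.
  rewrite /z /h ffunE inordK; have := zM i; lia.
under eq_bigr do rewrite -zE.
by apply: H; case: z0 => i zi; exists i; rewrite zE.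
Qed.

(** A unit vector is an admissible coefficient vector as soon as the bound is positive. *)
Lemma nonresonant_neq0 M n (p : 'I_n -> int) i : nonresonant M.+1 p -> p i != 0.
Proof.
move=> /(_ (fun j => (j == i)%:Z)) H; apply: contraPN (H _ _).
- move=> /eqP pi0; apply/negP; rewrite negbK (bigD1 i)//= pi0 mulr0 add0r.
  by rewrite big1// => j /negbTE ->; rewrite mul0r.
- by move=> j; case: eqP.
- by exists i; rewrite eqxx.
Qed.

Lemma nonresonant_leS M n (p : 'I_n -> int) : nonresonant M.+1 p -> nonresonant M p.
Proof. by move=> H zeta zM; apply: H => i; exact: leqW. Qed.

End cofinitely.

(** * From the absence of relations to pseudo-independence *)

Section pseudo_independence.
Variable R : realType.
Local Notation P := (uniform_prob (@ltr01 R)).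
Local Notation T := (measurableTypeR R).

Lemma cexpD (s t : R) : (cexp (s + t) : R[i]) = (cexp s : R[i]) * (cexp t : R[i]).
Proof.
rewrite /cexp mulrDr cosD sinD; apply/eqP; rewrite eq_complex/= eqxx/=.
by rewrite [eqbRHS]addrC.
Qed.

Lemma cexp0 : (cexp (0 : R) : R[i]) = 1.
Proof. by rewrite /cexp mulr0 cos0 sin0. Qed.

Lemma cexp_exprz (k : int) (t : R) : (cexp (k%:~R * t) : R[i]) = (cexp t : R[i]) ^ k.
Proof.
have cexp_exprn n s : (cexp (n%:R * s) : R[i]) = (cexp s : R[i]) ^+ n.
  elim: n => [|n ih]; first by rewrite mul0r cexp0.
  by rewrite -natr1 mulrDl mul1r cexpD ih exprSr.
have cexpN s : (cexp (- s) : R[i]) = (cexp s : R[i])^-1.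
  have c1 : (cexp (- s) : R[i]) * (cexp s : R[i]) = 1 by rewrite -cexpD addNr cexp0.
  have c0 : (cexp s : R[i]) != 0.
    by apply/eqP => c0; move/eqP: c1; rewrite c0 mulr0 eq_sym oner_eq0.
  by rewrite -[LHS]mulr1 -(mulfV c0) mulrA c1 mul1r.
case: k => n; first by rewrite cexp_exprn.
by rewrite NegzE rmorphN/= mulNr cexpN cexp_exprn.
Qed.

(** Telescoping: the factors are exchanged one at a time, the others being bounded by 1. *)
Lemma dist_prod_le I (r : seq I) (x y : I -> R) :
  (forall i, 0 <= x i <= 1) -> (forall i, 0 <= y i <= 1) ->
  `|\prod_(i <- r) x i - \prod_(i <- r) y i| <= \sum_(i <- r) `|x i - y i|.
Proof.
move=> x01 y01.
have p01 (z : I -> R) s : (forall i, 0 <= z i <= 1) -> 0 <= \prod_(i <- s) z i <= 1.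
  move=> z01; rewrite prodr_ge0/=; last by move=> i _; case/andP: (z01 i).
  by apply: prodr_ile1 => i _; exact: z01.
elim: r => [|i r ih]; first by rewrite !big_nil subrr normr0.
rewrite !big_cons.
have /andP[X0 X1] := p01 _ r x01; move: (x01 i) (y01 i) => /andP[? ?] /andP[? ?].
rewrite (_ : _ - _ = (x i - y i) * \prod_(j <- r) x j +
  y i * (\prod_(j <- r) x j - \prod_(j <- r) y j)); last by ring.
apply: (le_trans (ler_normD _ _)); apply: lerD; rewrite normrM.
  by rewrite ler_piMr// ger0_norm.
by apply: le_trans ih; rewrite ler_piMl// ger0_norm.
Qed.

(** The pointwise inequality [x <= e / 2 + x^2 / (2 e)] takes the place of Cauchy-Schwarz. *)
Lemma mean_dist_le (k : int) f g (e : R) : 0 < e ->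
  @bounded_measurable _ T R f -> @bounded_measurable _ T R g ->
  sqdist k f g <= e ^+ 2 ->
  mean P (fun t : T => `|f (k%:~R * t) - g (k%:~R * t)|) <= e.
Proof.
move=> e0 bf bg fge.
have bs := sqdist_bounded_measurable k bf bg.
have bd : @bounded_measurable _ T R (fun t : T => `|f (k%:~R * t) - g (k%:~R * t)|).
  by apply: bounded_measurable_norm; apply: bounded_measurableB;
    exact: dilate_bounded_measurable.
apply: (@le_trans _ _ (mean P (fun t : T => 2^-1 * e +
    (2^-1 * e^-1) * (f (k%:~R * t) - g (k%:~R * t)) ^+ 2))).
  apply: le_mean => //.
    apply: bounded_measurableD; first exact: bounded_measurable_cst.
    exact: bounded_measurableZ.
  move=> t; rewrite -[X in _ + _ * X]real_normK ?num_real//; set x := `|_|.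
  have : 0 <= (2^-1 * e^-1) * (e - x) ^+ 2.
    by apply: mulr_ge0; rewrite ?sqr_ge0// mulr_ge0// invr_ge0 ltW.
  rewrite (_ : _ * _ = 2^-1 * e - x + 2^-1 / e * x ^+ 2); last first.
    by field; rewrite gt_eqF.
  by lra.
rewrite meanD; [|exact: bounded_measurable_cst|exact: bounded_measurableZ].
rewrite mean_cst meanZ//.
have : (2^-1 * e^-1) * sqdist k f g <= (2^-1 * e^-1) * e ^+ 2.
  by apply: ler_wpM2l => //; rewrite mulr_ge0// invr_ge0 ltW.
rewrite (_ : _ * e ^+ 2 = 2^-1 * e); last by field; rewrite gt_eqF.
by rewrite /sqdist; lra.
Qed.

Lemma norm_mean_le f : @bounded_measurable _ T R f ->
  `|mean P f| <= mean P (fun t => `|f t|).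
Proof.
by move=> bf; apply: le_normr_Rintegral => //; exact: bounded_measurable_integrable.
Qed.

Lemma I_infty_pseudo_independent E : I_infty E -> pseudo_independent R E.
Proof.
have half2 (x : R) : 2^-1 * x + 2^-1 * x = x by field.
move=> IE n A n0 mA Acircle delta delta0.
pose B i := @cexp R @^-1` A i; pose f i : R -> R := \1_(B i).
have n0' : 0 < n%:R :> R by rewrite ltr0n.
(* Each of the [n] factors is replaced at cost [e], and this happens twice: inside the mean of the
   product, then in the product of the means. *)
pose e : R := delta / (2 * n%:R).
have e0 : 0 < e by rewrite divr_gt0// mulr_gt0.
have mB i : measurable (B i : set T).
  by rewrite -[B i]setTI; apply: measurable_cexp.
(* The tolerance is [e ^+ 2 / 4] because [sqdist_dilate] loses a factor 4. *)
have /choice[g gP] i : exists h : R -> R,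
    [/\ trigpoly h, unit_valued h & sqdist 1 (f i) h < e ^+ 2 / 4].
  have [_ _ /(_ (e ^+ 2 / 4))[|h [? ? fh]]] := approximable_borel (fun=> 1) (mA i).
    by rewrite divr_gt0// exprn_gt0.
  by exists h; split => //; exact: fh true.
have tg i : trigpoly (g i) by case: (gP i).
have bg i := trigpoly_bounded_measurable (tg i).
have bf i : @bounded_measurable _ T R (f i) by exact: bounded_measurable_indic.
have f01 i : unit_valued (f i).
  by move=> t; rewrite /f indicE; case: (_ \in _); rewrite /= ?lexx ler01.
have g01 i : unit_valued (g i) by case: (gP i).
have [M HM] := mean_prod_trigpoly tg.
(* [M.+1] in place of [M] ensures that every [p i] is nonzero, which [close] needs. *)
apply: cofinitely_sub (@I_infty_nonresonant E M.+1 n IE) => p ip Ep pM.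
have pE : fine (haar (@circle R `&` [set z | forall i, A i (echar (p i) z)])) =
    mean P (fun t : T => \prod_(i < n) f i ((p i)%:~R * t)).
  pose C := \bigcap_(i : 'I_n) [set t : T | B i ((p i)%:~R * t)].
  have mC : measurable C.
    apply: fin_bigcap_measurable => [|i _]; first exact: finite_finset.
    have mk : measurable_fun [set: T] (fun t : T => (p i)%:~R * t : T).
      exact: measurable_funM.
    by rewrite -[X in measurable X]setTI; exact: mk.
  transitivity (fine (P C)).
    congr (fine (P _)); apply/seteqP; split=> [t [_ /= At] i _|t Ct].
      by rewrite /B/= cexp_exprz; exact: At.
    split; first exact: circle_cexp.
    by move=> i /=; have := Ct i I; rewrite /B/= cexp_exprz.
  rewrite -mean_indic//; congr mean; apply/funext => t.
  rewrite indicE; have [|tC] := boolP (t \in C).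
    rewrite inE => Ct; rewrite big1// => i _.
    by rewrite /f indicE mem_set//; exact: Ct.
  have [i iC] : exists i, ~ B i ((p i)%:~R * t).
    by apply: contrapT => /forallNP h; move: tC; rewrite notin_setE; apply => i _;
      apply: contrapT; exact: h.
  by rewrite (bigD1 i)//= /f indicE memNset// mul0r.
have AE i : fine (haar (A i)) = mean P (f i) by rewrite mean_indic.
rewrite pE; under eq_bigr do rewrite AE.
have close k i : k != 0 ->
    mean P (fun t : T => `|f i (k%:~R * t) - g i (k%:~R * t)|) <= e.
  move=> k0; apply: mean_dist_le => //.
  have [_ _ fg] := gP i.
  by have := sqdist_dilate (mA i) (tg i) k0; rewrite -/(B i) -/(f i); lra.
pose D (h : 'I_n -> R -> R) : R -> R := fun t => \prod_(i < n) h i ((p i)%:~R * t).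
have bD h : (forall i, @bounded_measurable _ T R (h i)) ->
    @bounded_measurable _ T R (D h).
  by move=> bh; apply: bounded_measurable_prod => i; exact: dilate_bounded_measurable.
have sumE : \sum_(i < n) e = 2^-1 * delta.
  by rewrite sumr_const card_ord -mulr_natl /e; field; rewrite gt_eqF.
have bd k i : @bounded_measurable _ T R (fun t => `|f i (k%:~R * t) - g i (k%:~R * t)|).
  by apply: bounded_measurable_norm; apply: bounded_measurableB;
    exact: dilate_bounded_measurable.
have h1 : `|mean P (D f) - mean P (D g)| <= 2^-1 * delta.
  rewrite -meanB; [|exact: bD|exact: bD].
  apply: (le_trans (norm_mean_le _)); first by apply: bounded_measurableB; exact: bD.
  apply: (@le_trans _ _ (mean P (fun t : T =>
      \sum_(i < n) `|f i ((p i)%:~R * t) - g i ((p i)%:~R * t)|))).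
    apply: le_mean.
    - by apply: bounded_measurable_norm; apply: bounded_measurableB; exact: bD.
    - by apply: bounded_measurable_sum => i; exact: bd.
    - by move=> t; apply: dist_prod_le => i; [exact: f01 | exact: g01].
  rewrite mean_sum//; rewrite -sumE; apply: ler_sum => i _.
  by apply: close; exact: nonresonant_neq0 pM.
have h2 : `|mean P (D g) - \prod_(i < n) mean P (f i)| <= 2^-1 * delta.
  (* For the polynomials [g i] the mean of the product is exactly the product of the means; only the
     means of single factors remain to be compared. *)
  rewrite (HM _ (nonresonant_leS pM)).
  have mean01 (h : R -> R) : @bounded_measurable _ T R h -> unit_valued h ->
      0 <= mean P h <= 1.
    move=> bh h01; rewrite mean_ge0/=; last by move=> t; case/andP: (h01 t).
    rewrite -[leRHS](mean_cst P); apply: le_mean => //.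
      exact: bounded_measurable_cst.
    by move=> t; case/andP: (h01 t).
  apply: (le_trans (dist_prod_le _ _ _)).
  - by move=> i; exact: mean01.
  - by move=> i; exact: mean01.
  rewrite -sumE; apply: ler_sum => i _; rewrite distrC -meanB//.
  apply: (le_trans (norm_mean_le _)); first exact: bounded_measurableB.
  by have := close 1 i isT; under eq_fun do rewrite !mul1r.
rewrite (_ : _ - _ = (mean P (D f) - mean P (D g)) +
  (mean P (D g) - \prod_(i < n) mean P (f i))); last by ring.
by rewrite -[leRHS]half2; apply: (le_trans (ler_normD _ _)); exact: lerD.
Qed.

End pseudo_independence.

(** * Geometry of the circle and of its arcs *)

Section circle_geometry.
Variable R : realType.
Local Notation P := (uniform_prob (@ltr01 R)).
Local Notation T := (measurableTypeR R).
Local Open Scope complex_scope.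
Implicit Types z w : R[i].

Lemma circleP z : circle z <-> normc z = 1.
Proof.
rewrite /circle/= normE_normc; split => [|->//].
by move=> /(congr1 (@complex.Re R)).
Qed.

Lemma normc_sum I (r : seq I) (F : I -> R[i]) (Q : pred I) :
  normc (\sum_(i <- r | Q i) F i) <= \sum_(i <- r | Q i) normc (F i).
Proof.
elim/big_ind2: _ => [|x a y b xa yb|//]; first by rewrite normc0.
by apply: le_trans (le_normcD _ _) _; exact: lerD.
Qed.

Lemma normc_real (x : R) : 0 <= x -> normc x%:C = x.
Proof. by move=> x0; rewrite /normc/= expr0n/= addr0 sqrtr_sqr ger0_norm. Qed.

Lemma circle_exprz z (k : int) : circle z -> circle (z ^ k).
Proof.
rewrite /circle/= => z1; case: k => n; first by rewrite normrX z1 expr1n.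
by rewrite NegzE -exprnN normfV normrX z1 expr1n invr1.
Qed.

Lemma circle_parametrization z : circle z -> exists2 t : R, 0 <= t < 1 & cexp t = z.
Proof.
case: z => x y /circleP/(congr1 (fun r => r ^+ 2)).
rewrite /normc/= sqr_sqrtr ?addr_ge0 ?sqr_ge0// expr1n => xy.
have xle : x ^+ 2 <= 1 by rewrite -xy lerDl sqr_ge0.
have x11 : -1 <= x <= 1.
  by rewrite -ler_norml -(@ler_pXn2r _ 2)// ?nnegrE// real_normK ?num_real// expr1n.
have sinx : sin (acos x) = `|y|.
  by rewrite sin_acos// -xy addrAC subrr add0r sqrtr_sqr.
have cosx : cos (acos x) = x by rewrite acosK// in_itv/=.
have pi2 : 0 < pi *+ 2 :> R by rewrite pmulrn_lgt0// pi_gt0.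
have th0 := acos_ge0 x11; have thpi := acos_lepi x11.
pose t := acos x / (pi *+ 2).
have tE : pi *+ 2 * t = acos x by rewrite mulrC divfK// gt_eqF.
have t1 : t < 1.
  by rewrite ltr_pdivrMr// mul1r (le_lt_trans thpi)// mulr2n ltrDl pi_gt0.
have [y0|y0] := leP 0 y.
  exists t; first by rewrite t1 divr_ge0// ltW.
  by rewrite /cexp tE cosx sinx ger0_norm.
(* On the lower half circle the parameter is [1 - t]. It stays below 1 because [x = 1] would force
   [y = 0], so that [acos x > 0]. *)
have x1 : x < 1.
  rewrite lt_neqAle (andP x11).2 andbT; apply/eqP => x1.
  by move: xy; rewrite x1 expr1n => /eqP; rewrite -subr_eq0 addrAC subrr add0r
    sqrf_eq0 lt_eqF.
have t0 : 0 < t by rewrite divr_gt0// acos_gt0// x1 (andP x11).1.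
exists (1 - t); first by rewrite subr_ge0 (ltW t1) ltrBlDr ltrDl.
rewrite /cexp mulrBr mulr1 tE cosB sinB cos2pi sin2pi cosx sinx ltr0_norm//.
by rewrite !mul1r !mul0r addr0 add0r opprK.
Qed.

(** The chord depends only on [t - s], so continuity of [cos] at 0 already gives uniform
    continuity. *)
Lemma cexp_uniform (e : R) : 0 < e -> exists2 d : R, 0 < d &
  forall s t : R, `|t - s| < d -> normc ((cexp t : R[i]) - cexp s) < e.
Proof.
move=> e0.
have /cvgrPdist_lt/(_ (e ^+ 2 / 2)) :
    cos (pi *+ 2 * u + 0) @[u --> (0 : R)] --> cos (pi *+ 2 * 0 + 0).
  exact: continuous_cos_linear.
case; first by rewrite divr_gt0// exprn_gt0.
move=> d /= d0 dP; exists d => // s t std.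
have := dP (t - s); rewrite /ball_/= sub0r normrN mulr0 !addr0 cos0 => /(_ std).
move=> /(le_lt_trans (ler_norm _)) h.
rewrite -(@ltr_pXn2r _ 2)// ?nnegrE ?normc_ge0 ?(ltW e0)//.
rewrite normc_cexpB_sqr /halfchord -mulrBr.
by lra.
Qed.

Lemma measurable_circle : measurable (@circle R : set (borelC R)).
Proof.
have cc : closed (@circle R : set R[i]^o).
  apply: (@preimage_closed _ _ (Num.norm : R[i]^o -> R[i]^o) [set 1]).
    by move=> z _; exact: norm_continuous.
  exact/accessible_closed_set1/hausdorff_accessible/norm_hausdorff.
rewrite -[@circle R]setCK; apply: measurableC.
by apply: sub_sigma_algebra; exact: closed_openC.
Qed.

Definition arc w (e : R) : set (borelC R) :=
  @circle R `&` [set z : R[i] | normc (z - w) < e].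

Lemma measurable_arc w e : measurable (arc w e).
Proof.
apply: measurableI; first exact: measurable_circle.
apply: sub_sigma_algebra.
rewrite (_ : [set z | _] = ball (w : R[i]^o) e%:C); first exact: ball_open.
by apply/seteqP; split => z /=; rewrite -ball_normE/= distrC normE_normc ltcR.
Qed.

Lemma uniform_prob_itv (a b : R) : 0 <= a -> a < b -> b <= 1 ->
  P `[a, b] = (b - a)%:E.
Proof.
move=> a0 ab b1; rewrite /uniform_prob (eq_integral (fun=> 1%E)).
  by rewrite integral_cst//= mul1e lebesgue_measure_itv/= lte_fin ab.
move=> x; rewrite inE/= in_itv/= => /andP[ax xb].
by rewrite /uniform_pdf (le_trans a0 ax) (le_trans xb b1)/= subr0 invr1.
Qed.

Lemma haar_arc_gt0 (s e : R) : 0 <= s < 1 -> 0 < e ->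
  0 < fine (haar (arc (cexp s) e)).
Proof.
move=> /andP[s0 s1] /cexp_uniform[d d0 dP].
(* The interval [[s, b]] is cut at 1, where the uniform density stops; it is nondegenerate since
   [s < 1]. *)
pose b := Num.min (s + d / 2) 1.
have sb : s < b by rewrite lt_min s1 andbT ltrDl divr_gt0.
rewrite -lte_fin fineK; last exact: (fin_num_measure _ _ (measurable_arc _ _)).
apply: (@lt_le_trans _ _ (b - s)%:E); first by rewrite lte_fin subr_gt0.
rewrite -uniform_prob_itv//; last by rewrite ge_min lexx orbT.
apply: le_measure; rewrite ?inE//=.
  rewrite -[X in measurable X]setTI; apply: measurable_cexp => //.
  exact: measurable_arc.
move=> t /=; rewrite in_itv/= le_min => /andP[st /andP[td _]].
split; first exact: circle_cexp.
by apply: dP; rewrite ger0_norm ?subr_ge0//; lra.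
Qed.

(** The bound [M] guards against the default value that [sup] takes on unbounded sets. *)
Lemma supnorm_ge (f : R[i] -> R[i]) (M : R) z :
  (forall w, circle w -> normc (f w) <= M) -> circle z -> normc (f z) <= supnorm f.
Proof.
move=> fM cz; apply: ub_le_sup; last by exists z.
by exists M => _ [w cw <-]; exact: fM.
Qed.

Lemma supnorm_le (f : R[i] -> R[i]) (M : R) :
  (forall w, circle w -> normc (f w) <= M) -> supnorm f <= M.
Proof.
move=> fM; apply: ge_sup; last by move=> _ [w cw <-]; exact: fM.
by exists (normc (f 1)), 1 => //; rewrite /circle/= normr1.
Qed.

Lemma phase_exists z : exists2 u, circle u & z * u = (normc z)%:C.
Proof.
have [->|z0] := eqVneq z 0.
  by exists 1; [rewrite /circle/= normr1 | rewrite mul0r normc0].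
have nz : normc z != 0 by apply: contra z0 => /eqP/eq0_normc ->.
exists ((normc z)%:C / z); last by rewrite mulrC mulfVK.
by apply/circleP; rewrite normcM normcV normc_real ?normc_ge0// mulfV.
Qed.

Lemma circle_neq0 z : circle z -> z != 0.
Proof.
move=> cz; apply/eqP => z0; move: cz; rewrite z0 /circle/= normr0 => /esym/eqP.
by rewrite oner_eq0.
Qed.

Lemma normc_exprz_sub1 z (k : int) : circle z ->
  normc (z ^ k - 1) <= `|k|%N%:R * normc (z - 1).
Proof.
move=> cz; have hn (n : nat) : normc (z ^+ n - 1) <= n%:R * normc (z - 1).
  elim: n => [|n ih]; first by rewrite expr0 subrr normc0 mul0r.
  rewrite exprS (_ : _ - 1 = z * (z ^+ n - 1) + (z - 1)); last by ring.
  apply: (le_trans (le_normcD _ _)); rewrite normcM (circleP z).1// mul1r.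
  by rewrite -natr1 mulrDl mul1r lerD2r.
case: k => n /=; first exact: hn.
rewrite NegzE; set y := z ^ (- _).
have cy : normc y = 1 by apply/circleP; exact: circle_exprz.
have z0 := circle_neq0 cz.
have -> : y - 1 = - (y * (z ^+ n.+1 - 1)).
  rewrite mulrBr mulr1 opprB; congr (_ - _).
  by rewrite /y -exprnN mulVf// expf_neq0.
by rewrite normcN normcM cy mul1r; exact: hn.
Qed.

Lemma parallelogram z w :
  normc (z + w) ^+ 2 + normc (z - w) ^+ 2 = 2 * normc z ^+ 2 + 2 * normc w ^+ 2.
Proof.
case: z w => [a b] [c d]; rewrite /normc/= !sqr_sqrtr ?addr_ge0 ?sqr_ge0//.
by ring.
Qed.

Lemma normc_prod_sub1 n (x : 'I_n -> R[i]) : (forall i, circle (x i)) ->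
  normc (\prod_(i < n) x i - 1) <= \sum_(i < n) normc (x i - 1).
Proof.
move=> cx; elim: (index_enum _) => [|i r ih].
  by rewrite !big_nil subrr normc0.
rewrite !big_cons (_ : _ - 1 = x i * (\prod_(j <- r) x j - 1) + (x i - 1)); last by ring.
apply: (le_trans (le_normcD _ _)); rewrite normcM (circleP (x i)).1// mul1r addrC.
by rewrite lerD2l.
Qed.

End circle_geometry.

(** * Sidon constants of sets far out in E *)

Section sidon.
Variable R : realType.
Local Open Scope complex_scope.

(** Pseudo-independence handles finitely many products of arcs at a time. Rounding [u] to a finite
    net of the torus makes the exceptional set independent of [u]. *)
Lemma pseudo_independent_phases E m (e : R) : pseudo_independent R E ->
  (0 < m)%N -> 0 < e ->
  cofinitely E (fun p : 'I_m -> int => forall u : 'I_m -> R[i],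
    (forall i, circle (u i)) ->
    exists2 z, circle z & forall i, normc (z ^ p i - u i) < e).
Proof.
move=> iE m0 e0; have e2 : 0 < e / 2 by rewrite divr_gt0.
have [d d0 dP] := cexp_uniform e2.
pose N := Num.truncn d^-1.
have N0 : 0 < N.+1%:R :> R by [].
have Nd : N.+1%:R^-1 < d.
  rewrite -[ltRHS]invrK ltf_pV2 ?posrE ?invr_gt0//.
  exact: truncnS_gt.
pose s (l : 'I_N.+1) : R := l%:R / N.+1%:R.
have s01 l : 0 <= s l < 1 by rewrite divr_ge0//= ltr_pdivrMr// mul1r ltr_nat.
have : cofinitely E (fun p : 'I_m -> int => forall l : {ffun 'I_m -> 'I_N.+1},
    exists2 z : R[i], circle z &
    forall i, normc (z ^ p i - (cexp (s (l i)) : R[i])) < e / 2).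
  apply: cofinitely_forall => l.
  pose A i := arc (cexp (s (l i))) (e / 2).
  pose pr := \prod_(i < m) fine (haar (A i)).
  have pr0 : 0 < pr by apply: prodr_gt0 => i _; exact: haar_arc_gt0.
  have := iE m A m0 (fun i => measurable_arc _ _) (fun i => @subIsetl _ _ _) (pr / 2).
  move=> /(_ (divr_gt0 pr0 (ltr0n _ 2))).
  apply: cofinitely_sub => p _ _; rewrite -/pr => H; apply: contrapT => noz.
  (* Without such a [z] the event is empty, and its measure 0 differs from [pr] by more than
     [pr / 2]. *)
  move: H; rewrite (_ : _ `&` _ = set0) ?measure0/=.
    by rewrite sub0r normrN gtr0_norm// leNgt ltr_pdivrMr// mulr_natr mulr2n ltrDl pr0.
  rewrite -subset0 => z [cz Az]; apply: noz; exists z => // i.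
  by case: (Az i).
apply: cofinitely_sub => p _ _ H u cu.
have /choice[t tP] i : exists t : R, 0 <= t < 1 /\ cexp t = u i.
  by have [t t01 tu] := circle_parametrization (cu i); exists t.
pose l : {ffun 'I_m -> 'I_N.+1} := [ffun i => inord (Num.truncn (t i * N.+1%:R))].
have [z cz zP] := H l; exists z => // i.
have [/andP[t0 t1] tu] := tP i.
have /andP[k0 k1] : (Num.truncn (t i * N.+1%:R))%:R <= t i * N.+1%:R <
    (Num.truncn (t i * N.+1%:R)).+1%:R by rewrite truncn_itv// mulr_ge0.
have kN : (Num.truncn (t i * N.+1%:R) < N.+1)%N.
  by rewrite -(ltr_nat R) (le_lt_trans k0)// gtr_pMl.
have tl : `|t i - s (l i)| < d.
  apply: lt_trans Nd; rewrite /s /l ffunE inordK//.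
  rewrite ger0_norm ?subr_ge0 ?ler_pdivrMr// ltrBlDr -[X in X + _]mul1r -mulrDl.
  by rewrite ltr_pdivlMr// nat1r.
rewrite (_ : _ - _ = (z ^ p i - (cexp (s (l i)) : R[i])) -
  ((cexp (t i) : R[i]) - (cexp (s (l i)) : R[i]))); last by rewrite tu; ring.
apply: (le_lt_trans (le_normcD _ _)); rewrite normcN [ltRHS]splitr.
by apply: ltrD; [exact: zP | exact: dP].
Qed.

(** At a [z] that nearly aligns all terms with the positive axis, the polynomial differs from the
    sum [S] of the moduli of its coefficients by at most [S * e]. *)
Lemma phases_sidon_bound m (p : 'I_m -> int) (F : set int) (e : R) :
  0 < e < 1 -> F `<=` range p ->
  (forall u : 'I_m -> R[i], (forall i, circle (u i)) ->
    exists2 z, circle z & forall i, normc (z ^ p i - u i) < e) ->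
  sidon_bound F (1 - e)^-1.
Proof.
move=> /andP[e0 e1] Fp H A a AF.
have /choice[u uP] q : exists u, circle u /\ a q * u = (normc (a q))%:C.
  by have [v cv av] := phase_exists (a q); exists v.
have [z cz zP] := H (u \o p) (fun i => (uP (p i)).1).
pose f (w : R[i]) : R[i] := \sum_(q <- A) a q * echar q w.
rewrite -[X in supnorm X]/f; set S := \sum_(q <- A) _.
have fS w : circle w -> normc (f w) <= S.
  move=> cw; apply: (le_trans (normc_sum _ _ _)); apply: ler_sum => q _.
  by rewrite normcM (circleP (w ^ q)).1 ?mulr1//; exact: circle_exprz.
rewrite mulrC ler_pdivlMr ?subr_gt0//.
apply: (@le_trans _ _ (normc (f z))); last exact: supnorm_ge fS cz.
have SE : normc (S%:C - f z) <= S * e.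
  rewrite /S rmorph_sum/= /f -sumrB.
  apply: (le_trans (normc_sum _ _ _)); rewrite mulr_suml big_seq [leRHS]big_seq.
  apply: ler_sum => q qA.
  have [i _ pq] := Fp _ (AF _ qA).
  rewrite -(uP q).2 -mulrBr normcM; apply: ler_wpM2l; first exact: normc_ge0.
  by rewrite -normcN opprB /echar -pq; exact/ltW/(zP i).
have S0 : 0 <= S by apply: sumr_ge0 => q _; exact: normc_ge0.
rewrite mulrBr mulr1 lerBlDr -{1}(normc_real S0).
rewrite (_ : S%:C = f z + (S%:C - f z)); last by rewrite addrC subrK.
by apply: (le_trans (le_normcD _ _)); rewrite lerD2l.
Qed.

Lemma pseudo_independent_sidon E (eps : R) m : pseudo_independent R E ->
  0 < eps -> (1 <= m)%N ->
  exists G : set int, [/\ finite_set G, G `<=` E &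
    forall F : set int, F `<=` E `\` G -> (F #= `I_m)%card ->
      (sidon_constant R F < (1 + eps)%:E)%E].
Proof.
(* This [e] gives [(1 - e)^-1 = 1 + eps / 2], strictly below [1 + eps]. *)
move=> iE eps0 m1; pose e := eps / (2 + eps).
have eps2 : 0 < 2 + eps by rewrite addr_gt0.
have e0 : 0 < e by rewrite divr_gt0.
have e1 : e < 1 by rewrite ltr_pdivrMr// mul1r ltrDr.
have [G [fG GE GP]] := pseudo_independent_phases iE m1 e0.
exists G; split => // F FE /card_set_bijP[f [fF fi fs]].
have /choice[p pP] (i : 'I_m) : exists q, F q /\ f q = i.
  by have [q Fq fq] := fs i (ltn_ord i); exists q.
have ip : injective p.
  by move=> i j pij; apply: val_inj; rewrite /= -(pP i).2 -(pP j).2 pij.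
have Ep i : (E `\` G) (p i) by apply: FE; case: (pP i).
have Fp : F `<=` range p.
  move=> q Fq; exists (Ordinal (fF q Fq)) => //.
  by apply: fi; rewrite ?inE//; case: (pP (Ordinal (fF q Fq))).
have := phases_sidon_bound _ Fp (GP p ip Ep); rewrite e0 e1 => /(_ isT) bF.
apply: (@le_lt_trans _ _ (1 - e)^-1%:E).
  by apply: ereal_inf_lbound; exists (1 - e)^-1.
rewrite lte_fin (_ : (1 - e)^-1 = 1 + eps / 2).
  by rewrite ltrD2l ltr_pdivrMr// mulr_natr mulr2n ltrDl.
by rewrite /e; field; rewrite (gt_eqF eps2)/= addrK pnatr_eq0.
Qed.

Lemma fset_range k (r : 'I_k -> int) : injective r ->
  exists A : {fset int}, [set` A] = range r /\
    forall (V : nmodType) (g : int -> V), \sum_(q <- A) g q = \sum_(i < k) g (r i).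
Proof.
move=> ir; pose A := [fset q | q in map r (enum 'I_k)]%fset.
exists A; split=> [|V g].
  apply/seteqP; split => q /=.
    by rewrite !inE/= => /mapP[i _ ->]; exists i.
  by move=> [i _ <-]; rewrite !inE/=; apply: map_f; rewrite mem_enum.
transitivity (\sum_(q <- map r (enum 'I_k)) g q); last by rewrite big_map big_enum.
apply: perm_big; apply: uniq_perm; first exact: fset_uniq.
  by rewrite map_inj_uniq ?enum_uniq.
by move=> q; rewrite !inE.
Qed.

(* By the parallelogram identity, unit vectors whose sum is almost as long as
   possible almost coincide. *)
Lemma unit_vectors_close k (v : 'I_k -> R[i]) (tau : R) i j :
  0 <= tau <= 2 -> (forall i, circle (v i)) ->
  k%:R - tau < normc (\sum_(i < k) v i) -> normc (v i - v j) ^+ 2 <= 4 * tau.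
Proof.
move=> /andP[tau0 tau2] cv vk.
have nv l : normc (v l) = 1 by exact/circleP.
have [->|ij] := eqVneq i j; first by rewrite subrr normc0 expr0n/= mulr_ge0.
have := vk; rewrite (bigD1 i)//= (bigD1 j)/=; last by rewrite eq_sym.
rewrite addrA => {}vk.
(* The other [k - 2] unit vectors add at most [k - 2], so [v i + v j] is longer than [2 - tau]; this
   leaves at most [4 - (2 - tau)^2 <= 4 tau] for the squared difference. *)
have rest : normc (\sum_(l < k | (l != i) && (l != j)) v l) <= k%:R - 2.
  apply: (le_trans (normc_sum _ _ _)); rewrite (eq_bigr (fun=> 1)); last by move=> l _.
  have : \sum_(l < k) (1 : R) = k%:R by rewrite sumr_const card_ord.
  rewrite (bigD1 i)//= (bigD1 j)/=; last by rewrite eq_sym.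
  by move=> <-; lra.
have vij : 2 - tau < normc (v i + v j).
  have := lt_le_trans vk (le_trans (le_normcD _ _) (lerD (lexx _) rest)).
  by rewrite addrCA ltrD2l ltrBrDr [- tau + _]addrC.
have aux (x y : R) : x ^+ 2 + y ^+ 2 = 2 * 1 ^+ 2 + 2 * 1 ^+ 2 ->
    (2 - tau) ^+ 2 <= x ^+ 2 -> y ^+ 2 <= 4 * tau.
  by have := sqr_ge0 tau; lra.
have := parallelogram (v i) (v j); rewrite !nv => /aux; apply.
by rewrite ler_pXn2r// ?nnegrE ?normc_ge0 ?subr_ge0// ltW.
Qed.

Lemma prod_exprz I (s : seq I) (z : R[i]) (e : I -> int) : z != 0 ->
  \prod_(i <- s) z ^ e i = z ^ (\sum_(i <- s) e i).
Proof.
move=> z0; elim: s => [|i s ih]; first by rewrite !big_nil expr0z.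
by rewrite !big_cons ih expfzDr.
Qed.

Lemma cexp_half : (cexp (2^-1 : R) : R[i]) = -1.
Proof.
rewrite /cexp (_ : pi *+ 2 * 2^-1 = pi); last by rewrite mulr2n; field.
by rewrite cospi sinpi; apply/eqP; rewrite eq_complex/= oppr0 !eqxx.
Qed.

Lemma sidon_I_infty E :
  (forall (eps : R) (m : nat), 0 < eps -> (1 <= m)%N ->
    exists G : set int, [/\ finite_set G, G `<=` E &
      forall F : set int, F `<=` E `\` G -> (F #= `I_m)%card ->
        (sidon_constant R F < (1 + eps)%:E)%E]) -> I_infty E.
Proof.
move=> HS k zeta k0 z0 zsum.
pose i0 := Ordinal k0.
pose Z := (\sum_(i < k) `|zeta i|)%N.
(* [kappa] is chosen so that [Z * kappa <= 1], and [tau] so that [unit_vectors_close] yields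
   distances at most [kappa]. *)
pose kappa : R := Z.+1%:R^-1.
have kappa0 : 0 < kappa by rewrite invr_gt0.
have kappa1 : kappa <= 1 by rewrite invf_le1// ler1n.
pose tau := kappa ^+ 2 / 4.
have tau0 : 0 < tau by rewrite divr_gt0// exprn_gt0.
have tau1 : tau <= 1 by have := exprn_ile1 2 (ltW kappa0) kappa1; rewrite /tau; lra.
have k0' : 0 < k%:R :> R by rewrite ltr0n.
(* With this margin a sup norm at most [k - tau] is contradictory, since [(1 + tau / k) (k - tau) =
   k - tau^2 / k < k]. *)
have [G [fG GE GP]] := HS (tau / k%:R) k (divr_gt0 tau0 k0') k0.
exists G; split => // r ir Er; apply/eqP => rz.
(* The phase [c] is put at [r i0] alone and 1 elsewhere; as [c ^ zeta i0 = -1], the product of the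
   [a (r i) ^ zeta i] is -1. *)
pose c : R[i] := cexp (2^-1 / (zeta i0)%:~R : R).
have cc : circle c by exact: circle_cexp.
have cz : c ^ zeta i0 = -1.
  by rewrite -cexp_exprz mulrC divfK ?cexp_half// intr_eq0.
pose a q : R[i] := if q == r i0 then c else 1.
have ca q : circle (a q).
  by rewrite /a; case: ifP => // _; rewrite /circle/= normr1.
have aprod : \prod_(i < k) a (r i) ^ zeta i = -1.
  rewrite (bigD1 i0)//= {1}/a eqxx cz big1 ?mulr1// => i ii0.
  by rewrite /a (inj_eq ir) (negbTE ii0) exp1rz.
have [_ [C CP <-]] : exists2 y, [set C%:E | C in @sidon_bound R (range r)] y &
    (y < (1 + tau / k%:R)%:E)%E.
  apply: ereal_inf_lt; apply: GP; first by move=> _ [i _ <-]; exact: Er.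
  apply: card_eq_trans (card_esym (@card_II k)).
  by apply: inj_card_eq => i j _ _; exact: ir.
rewrite lte_fin => Ck.
have [A [Ar sumA]] := fset_range ir.
have := CP A a; rewrite Ar sumA => /(_ (fun _ => id)).
pose f (z : R[i]) : R[i] := \sum_(q <- A) a q * echar q z.
rewrite -[X in supnorm X]/f.
rewrite (eq_bigr (fun=> 1)); last by move=> i _; exact/circleP/ca.
rewrite sumr_const card_ord => kC.
have fle z : circle z -> normc (f z) <= k%:R - tau.
  move=> czz; rewrite leNgt; apply/negP => fz.
  pose v i := a (r i) * z ^ r i.
  have cv i : circle (v i).
    by apply/circleP; rewrite normcM !(circleP _).1 ?mulr1//; exact: circle_exprz.
  have vclose i : normc (v i / v i0 - 1) <= kappa.
    have vi0 := circle_neq0 (cv i0).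
    rewrite -[X in _ - X](divff vi0) -mulrBl normcM normcV.
    rewrite [normc (v i0)](circleP _).1// invr1 mulr1.
    rewrite -(@ler_pXn2r _ 2)// ?nnegrE ?normc_ge0 ?(ltW kappa0)//.
    rewrite (_ : kappa ^+ 2 = 4 * tau); last by rewrite /tau mulrC divfK.
    apply: unit_vectors_close => //; first by apply/andP; split; lra.
    by move: fz; rewrite /f sumA.
  have cw i : circle (v i / v i0).
    by apply/circleP; rewrite normcM normcV !(circleP _).1// invr1 mulr1.
  (* The powers of [v i0] cancel because the [zeta i] sum to 0, those of [z] because of the relation
     [rz]; only the phases remain. *)
  have prodE : \prod_(i < k) (v i / v i0) ^ zeta i = -1.
    have czn := circle_neq0 czz.
    under eq_bigr do rewrite expfzMl.
    rewrite big_split/= (_ : \prod_(i < k) (v i0)^-1 ^ zeta i = 1); last first.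
      by rewrite prod_exprz ?invr_eq0 ?circle_neq0// zsum expr0z.
    rewrite mulr1; under eq_bigr do rewrite expfzMl exprz_exp.
    rewrite big_split/= aprod prod_exprz//.
    by under eq_bigr do rewrite mulrC; rewrite rz expr0z mulr1.
  (* The product would lie within [Z * kappa <= 1] of 1, whereas -1 is at distance 2. *)
  have := normc_prod_sub1 (fun i => circle_exprz (zeta i) (cw i)).
  rewrite prodE leNgt => /negP; apply.
  have -> : normc (-1 - 1 : R[i]) = 2.
    have -> : -1 - 1 = - (1 + 1)%:C :> R[i] by rewrite rmorphD opprD.
    by rewrite normcN normc_real.
  apply: (@le_lt_trans _ _ (\sum_(i < k) `|zeta i|%N%:R * kappa)).
    apply: ler_sum => i _; apply: (le_trans (normc_exprz_sub1 _ (cw i))).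
    by apply: ler_wpM2l.
  rewrite -mulr_suml -natr_sum -/Z.
  apply: (@le_lt_trans _ _ 1); last by rewrite ltr1n.
  by rewrite ler_pdivrMr// mul1r ler_nat.
have sf := supnorm_le fle.
have sf0 : 0 <= supnorm f.
  have c1 : circle (1 : R[i]) by rewrite /circle/= normr1.
  exact: le_trans (normc_ge0 _) (supnorm_ge fle c1).
have : k%:R <= (1 + tau / k%:R) * (k%:R - tau).
  apply: (le_trans kC); apply: (@le_trans _ _ ((1 + tau / k%:R) * supnorm f)).
    by apply: ler_wpM2r => //; exact: ltW.
  by apply: ler_wpM2l => //; rewrite addr_ge0// divr_ge0// ltW.
rewrite (_ : _ * _ = k%:R - tau ^+ 2 / k%:R); last by field; rewrite gt_eqF.
by rewrite leNgt gtrBl divr_gt0// exprn_gt0.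
Qed.

End sidon.

Theorem proposition12p2p1 (R : realType) (E : set int) :
  (pseudo_independent R E <-> I_infty E) /\
  (I_infty E <->
   forall (eps : R) (m : nat), 0 < eps -> (1 <= m)%N ->
     exists G : set int, [/\ finite_set G, G `<=` E &
       forall F : set int, F `<=` E `\` G -> (F #= `I_m)%card ->
         (sidon_constant R F < (1 + eps)%:E)%E]).
Proof.
split; split.
- by move=> iE; apply: (@sidon_I_infty R) => eps m; exact: pseudo_independent_sidon.
- exact: I_infty_pseudo_independent.
- by move=> /(@I_infty_pseudo_independent R) iE eps m; exact: pseudo_independent_sidon.
- exact: sidon_I_infty.
Qed.
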